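(* Let $n\ge 1$ and let $\mu$ be an unconditional product measure with decreasing density on $\mathbb{R}^n$. Then for all non-empty ideals $A,B\subseteq\mathbb{R}^n$ and all $\lambda\in[0,1]$, $$\mu(\lambda A+(1-\lambda)B)^{1/n}\ \ge\ \lambda\,\mu(A)^{1/n}+(1-\lambda)\,\mu(B)^{1/n}.$$
   Context: A function $f:\mathbb{R}^n\to\mathbb{R}$ is unconditional if $f(\varepsilon_1x_1,\ldots,\varepsilon_nx_n)=f(x)$ for all $x\in\mathbb{R}^n$ and all signs $\varepsilon_i\in\{-1,1\}$. An unconditional function $f$ is decreasing if for every $i$ and all fixed values of the other coordinates, the function $t\mapsto f(x_1,\ldots,x_{i-1},t,x_{i+1},\ldots,x_n)$ is non-increasing on $[0,\infty)$. A set $A\subseteq\mathbb{R}^n$ is an ideal if $\mathbf{1}_A$ is unconditional and decreasing, i.e. $(x_1,\ldots,x_n)\in A$ implies $(\delta_1x_1,\ldots,\delta_nx_n)\in A$ for all $\delta_1,\ldots,\delta_n\in[-1,1]$. An unconditional product measure with decreasing density on $\mathbb{R}^n$ is a measure $\mu=\mu_1\otimes\cdots\otimes\mu_n$ (each $\mu_i$ a measure on $\mathbb{R}$) having a density $\varphi:\mathbb{R}^n\to[0,\infty)$ with respect to Lebesgue measure which is unconditional and decreasing; so $\mu(A)=\int_A\varphi(x)\,dx$ for Lebesgue measurable $A$. The measure $\mu$ need not be finite; inequalities are understood in $[0,\infty]$ with $0\cdot\infty=0$. For sets $A,B$ and scalars $s,t$: $sA+tB=\{sa+tb: a\in A, b\in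 B\}$. *)

(* Defs.v *)
From HB Require Import structures.
From mathcomp Require Import all_boot all_order all_algebra.
From mathcomp Require Import all_classical all_reals all_analysis.
Set Implicit Arguments.
Unset Strict Implicit.
Unset Printing Implicit Defensive.
Import Order.TTheory GRing.Theory Num.Theory.
Import numFieldNormedType.Exports.
Local Open Scope classical_set_scope.
Local Open Scope ring_scope.

(* R^n is [n.-tuple R] with R carrying its Borel sigma-algebra, so that the
   library's product sigma-algebra on tuples is the Borel one of R^n. *)
Notation Rn R n := (n.-tuple (measurableTypeR R)).

Section lebesgue_cons.
Context (R : realType) (n : nat).

Definition Rn_cons (p : measurableTypeR R * Rn R n) : Rn R n.+1 :=
  [tuple of p.1 :: p.2].

Lemma measurable_Rn_cons : measurable_fun setT Rn_cons.
Proof. exact: (measurable_cons measurable_fst measurable_snd). Qed.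

Variable m : {sigma_finite_measure set (Rn R n) -> \bar R}.

Definition lebesgue_cons : set (Rn R n.+1) -> \bar R :=
  pushforward (lebesgue_measure \x m)%E Rn_cons.

Let lebesgue_cons0 : lebesgue_cons set0 = 0%E.
Proof. by rewrite /lebesgue_cons /pushforward preimage_set0 measure0. Qed.

Let lebesgue_cons_ge0 A : (0 <= lebesgue_cons A)%E.
Proof. exact: (measure_ge0 (lebesgue_measure \x m)%E). Qed.

Let lebesgue_cons_sigma_additive : semi_sigma_additive lebesgue_cons.
Proof.
move=> F mF tF mUF; rewrite /lebesgue_cons /pushforward preimage_bigcup.
apply: measure_semi_sigma_additive.
- by move=> k; rewrite -[X in measurable X]setTI; exact: measurable_Rn_cons.
- apply/trivIsetP => /= i j _ _ ij; rewrite -preimage_setI.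
  by move/trivIsetP : tF => /(_ _ _ _ _ ij) ->//; rewrite preimage_set0.
- rewrite -preimage_bigcup -[X in measurable X]setTI.
  exact: measurable_Rn_cons.
Qed.

HB.instance Definition _ := isMeasure.Build _ _ _ lebesgue_cons
  lebesgue_cons0 lebesgue_cons_ge0 lebesgue_cons_sigma_additive.

Let lebesgue_cons_sigma_finite : sigma_finite setT lebesgue_cons.
Proof.
have /sigma_finiteP[F [FT ndF Foo]] :=
  sigma_finiteT (lebesgue_measure : set (measurableTypeR R) -> \bar R).
have /sigma_finiteP[G [GT ndG Goo]] := sigma_finiteT m.
pose g (t : Rn R n.+1) : measurableTypeR R * Rn R n :=
  (thead t, [tuple of behead t]).
have gK : cancel Rn_cons g.
  move=> [x t]; congr (_, _); exact/val_inj.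
have mg : measurable_fun setT g.
  apply/measurable_fun_pair => /=.
    exact: measurable_tnth.
  exact: measurable_behead.
exists (fun k => g @^-1` (F k `*` G k)).
  rewrite predeqE => t; split=> // _.
  have [k1 _ Fk1] : (\bigcup_k F k) (g t).1 by rewrite -FT.
  have [k2 _ Gk2] : (\bigcup_k G k) (g t).2 by rewrite -GT.
  exists (maxn k1 k2) => //; split.
    by apply: (subsetPset _ _ (ndF _ _ (leq_maxl k1 k2))).
  by apply: (subsetPset _ _ (ndG _ _ (leq_maxr k1 k2))).
move=> k; have [mF Fk] := Foo k; have [mG Gk] := Goo k; split.
  by rewrite -[X in measurable X]setTI; apply: mg => //; exact: measurableX.
rewrite /lebesgue_cons /pushforward.
suff -> : Rn_cons @^-1` (g @^-1` (F k `*` G k)) = F k `*` G k.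
  by rewrite product_measure1E// lte_mul_pinfty// ge0_fin_numE.
by apply/seteqP; split=> p; rewrite /preimage /mkset gK.
Qed.

HB.instance Definition _ := Measure_isSigmaFinite.Build _ _ _ lebesgue_cons
  lebesgue_cons_sigma_finite.

End lebesgue_cons.

Fixpoint borel_lebesgue (R : realType) (n : nat) :
    {sigma_finite_measure set (Rn R n) -> \bar R} :=
  match n with
  | 0 => \d_([tuple] : Rn R 0)
  | n'.+1 => lebesgue_cons (borel_lebesgue R n')
  end.
Arguments borel_lebesgue : clear implicits.

(* Ideals need not be Borel, hence the completion: [Rn_lebesgue R n] is R^n with
   the sigma-algebra of Lebesgue (i.e. Caratheodory) measurable sets. *)
Notation Rn_lebesgue R n := (caratheodory_type (borel_lebesgue R n)^*%mu).

Definition lebesgue_Rn (R : realType) (n : nat) : set (Rn_lebesgue R n) -> \bar R :=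
  @completed_measure_extension _ _ _ (borel_lebesgue R n).
Arguments lebesgue_Rn : clear implicits.

HB.instance Definition _ (R : realType) (n : nat) :=
  Measure.on (lebesgue_Rn R n).

Section ideals.
Context (R : realType) (n : nat).
Implicit Types (f : Rn R n -> R) (x : Rn R n) (A B : set (Rn R n)).

Definition unconditional f : Prop :=
  forall x (e : 'I_n -> R), (forall i, e i = 1 \/ e i = -1) ->
    f [tuple e i * tnth x i | i < n] = f x.

Definition set_coord x (i : 'I_n) (t : R) : Rn R n :=
  [tuple if j == i then t else tnth x j | j < n].

Definition coord_decreasing f : Prop :=
  forall x (i : 'I_n) (s t : R), 0 <= s -> s <= t ->
    f (set_coord x i t) <= f (set_coord x i s).

Definition is_ideal A : Prop :=
  unconditional (\1_A : Rn R n -> R) /\ coord_decreasing (\1_A : Rn R n -> R).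

Definition minkowski_comb (s t : R) A B : set (Rn R n) :=
  [set [tuple s * tnth a i + t * tnth b i | i < n] | a in A & b in B].

Definition box (X : 'I_n -> set R) : set (Rn R n) :=
  [set x | forall i, X i (tnth x i)].

(* The defining identity of the product measure on Borel boxes. In [\bar R],
   0 * +oo = 0. No sigma-finiteness is required of the [m i]: if mu has a
   density that is bounded on bounded sets and mu != 0, it is automatic. *)
Definition is_product_measure (mu : {measure set (Rn_lebesgue R n) -> \bar R})
    (m : 'I_n -> {measure set (measurableTypeR R) -> \bar R}) : Prop :=
  forall X : 'I_n -> set (measurableTypeR R), (forall i, measurable (X i)) ->
    mu (box X) = (\prod_(i < n) m i (X i))%E.

Definition has_density (mu : {measure set (Rn_lebesgue R n) -> \bar R})
    (phi : Rn_lebesgue R n -> R) : Prop :=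
  [/\ measurable_fun setT phi,
      forall x, 0 <= phi x &
      forall A : set (Rn_lebesgue R n), measurable A ->
        mu A = (\int[lebesgue_Rn R n]_(x in A) (phi x)%:E)%E].

Definition unconditional_product_measure_decreasing_density
    (mu : {measure set (Rn_lebesgue R n) -> \bar R}) : Prop :=
  (exists m, is_product_measure mu m) /\
  (exists phi : Rn_lebesgue R n -> R,
    [/\ has_density mu phi, unconditional phi & coord_decreasing phi]).

End ideals.

(* Main.v *)
From HB Require Import structures.
Require Import Defs.
From mathcomp Require Import all_boot all_order all_algebra.
From mathcomp Require Import all_classical all_reals all_analysis.
From mathcomp Require Import measurable_realfun.
From mathcomp Require Import ring lra.
Set Implicit Arguments.
Unset Strict Implicit.
Unset Printing Implicit Defensive.
Import Order.TTheory GRing.Theory Num.Theory.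
Import numFieldNormedType.Exports.
Local Open Scope classical_set_scope.
Local Open Scope ring_scope.

(** The proof rests on a functional inequality on the line, carried to higher
    dimensions by slicing.

    Take a measure on the line with an even density that decreases away from the
    origin.  An affine map that multiplies lengths by r and moves points towards
    the origin multiplies the measure by at least r; this property is
    [decreasing_measure].  Hence, for symmetric intervals I and
    J, say I included in J, the measure of l I + (1 - l) J is at least
    l m(I) + (1 - l) m(J): the part of J outside I is contracted towards I by
    the ratio 1 - l ([brunn_minkowski_line]).  Summing this over superlevel
    sets gives a lower bound for the integral of h when
    h (l x + (1 - l) y) >= M min (f x, g y) and f, g are even, decreasing and
    of maximum 1 ([functional_brunn_minkowski]).

    For a product of such measures on R^n the dimension enters
    multiplicatively.  Fix p in [0, 1] and a constant c such that
    c X^p Y^(1-p) <= l X + (1 - l) Y for all nonnegative X and Y.  Then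
    mu(l A + (1 - l) B) >= c^n mu(A)^p mu(B)^(1-p), by induction on n
    ([brunn_minkowski_powR]): f and g are the measures of the slices of A and
    of B divided by the measures of their central slices, which are the largest
    ones, and each dimension contributes one factor c.  For
    p = l a / (l a + (1 - l) b), with a and b the n-th roots of the two
    measures, the best constant c turns the right-hand side into
    (l a + (1 - l) b)^n ([brunn_minkowski_bounded]); exhausting by cubes removes
    the boundedness assumption ([brunn_minkowski_solid]).

    Two gaps remain between this inequality and the theorem.  Ideals need not
    be Borel.  An ideal lies between a union of boxes with rational vertices,
    [inner], and the complement of such a union, [outer]; contracting [outer]
    by any factor t < 1 brings it inside [inner], so the inequality applied to
    (1 - t) {0} + t outer, with t tending to 1, shows that the two hulls have
    the same measure ([prodm_outerD_inner]).  Applied to Lebesgue measure this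
    also shows that ideals are Lebesgue measurable.  Secondly, the density is
    not assumed to be a product of functions of one variable.  The marginals
    are nevertheless decreasing: on a slab, an affine change of the i-th
    variable in the integral of the density yields the contraction inequality
    for the i-th marginal ([marginal_decreasing]), and the measure agrees with
    the product of its marginals on Borel sets ([density_prodm]). *)

(** * Sets and measures on the line *)

Section line.
Context (R : realType).
Implicit Types (I J K S : set (measurableTypeR R)).

Definition solid1 I := forall x y : R, `|y| <= `|x| -> I x -> I y.

Definition seg (a : R) : set (measurableTypeR R) := [set x | `|x| <= a].

(** This expresses that the measure has an even density decreasing away from the
    origin, without mentioning the density: the image of E under an affine map
    of ratio r has r times the length of E, and where the map decreases the
    absolute value the density does not decrease.  In this form the property
    passes from a density on R^n to the marginals. *)
Definition decreasing_measure (m : set (measurableTypeR R) -> \bar R) :=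
  forall (r c : R) E D, 0 < r -> measurable E -> measurable D ->
    (forall x, E x -> D (r * x + c) /\ `|r * x + c| <= `|x|) ->
    (r%:E * m E <= m D)%E.

Lemma segE a : seg a = `[- a, a]%classic.
Proof. by apply/seteqP; split=> x; rewrite /seg /= in_itv /= ler_norml. Qed.

Lemma measurable_seg a : measurable (seg a).
Proof. by rewrite segE; exact: measurable_itv. Qed.

Lemma solid1_total I J : solid1 I -> solid1 J -> I `<=` J \/ J `<=` I.
Proof.
move=> sI sJ; have [|/existsNP[x /not_implyP[Ix nJx]]] := pselect (I `<=` J).
  by left.
right=> y Jy; apply: (sI x) => //; rewrite leNgt; apply/negP => /ltW xy.
by apply: nJx; exact: sJ Jy.
Qed.

(** The segments are closed while I may be open, so that the supremum of I need
    not be attained: in that case the radii tend to it from below. *)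
Lemma solid1_exhaust I : I 0 -> solid1 I -> exists u : nat -> R,
  [/\ (forall k, 0 <= u k /\ I (u k)), nondecreasing_seq u &
      I = \bigcup_k seg (u k)].
Proof.
move=> I0 sI.
suff [u [u0 ndu uI]] : exists u : nat -> R,
   [/\ (forall k, 0 <= u k /\ I (u k)), nondecreasing_seq u &
      forall x, I x -> exists k, `|x| <= u k].
  exists u; split=> //; apply/seteqP; split=> x.
    by move=> /uI[k xk]; exists k.
  move=> [k _]; rewrite /seg /= => xk; have [uk0 Iuk] := u0 k.
  by apply: sI Iuk; rewrite (ger0_norm uk0).
have [hI|nI] := pselect (has_ubound I); last first.
  exists (fun k => k%:R); split.
  - move=> k; split=> //; apply: contrapT => nIk; apply: nI.
    exists k%:R => x Ix; rewrite leNgt; apply/negP => kx; apply: nIk.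
    by apply: sI Ix; rewrite !ger0_norm//; [exact: ltW|exact: le_trans (ltW kx)].
  - by move=> i j ij; rewrite ler_nat.
  - move=> x _; exists (Num.bound `|x|); apply/ltW; exact: archi_boundP.
have nnI x : I x -> I `|x| by apply: sI; rewrite normr_id.
have Is x : I x -> `|x| <= sup I by move=> /nnI Ix; exact: ub_le_sup.
have s0 : 0 <= sup I by exact: le_trans (normr_ge0 _) (Is _ I0).
have [Isup|nIsup] := pselect (I (sup I)).
  by exists (fun=> sup I); split=> // x /Is; exists 0%N.
have below t : 0 <= t -> t < sup I -> I t.
  move=> t0 /(sup_gt (ex_intro _ 0 I0))[x Ix tx]; apply: sI Ix.
  by rewrite !ger0_norm//; [exact: ltW|exact: le_trans (ltW tx)].
have sgt0 : 0 < sup I by rewrite lt_neqAle s0 andbT; apply/eqP => E; rewrite -E in nIsup.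
pose u k := sup I * (1 - k.+1%:R^-1).
have iv k : 0 < (k.+1%:R^-1 : R) <= 1 by rewrite invr_gt0 ltr0n /= invf_le1 ?ler1n.
exists u; split.
- move=> k; have /andP[i0 i1] := iv k.
  have u0 : 0 <= u k by rewrite mulr_ge0// subr_ge0.
  by split=> //; apply: below => //; rewrite /u gtr_pMr// gtrBl.
- move=> i j ij; rewrite /u ler_pM2l// lerD2l lerN2.
  by rewrite lef_pV2 ?posrE ?ltr0n// ler_nat ltnS.
- move=> x Ix; have xs : `|x| < sup I.
    rewrite lt_neqAle Is// andbT; apply/eqP => xE; apply: nIsup.
    by rewrite -xE; exact: nnI.
  pose e := 1 - `|x| / sup I.
  have e0 : 0 < e by rewrite subr_gt0 ltr_pdivrMr ?mul1r.
  have [k ke] : exists k, k.+1%:R^-1 < e.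
    exists (Num.bound e^-1); rewrite invf_plt ?posrE ?ltr0n//.
    apply: (lt_le_trans (archi_boundP _)); first by rewrite invr_ge0 ltW.
    by rewrite ler_nat.
  exists k; rewrite /u mulrC -ler_pdivrMr//.
  by rewrite lerBrDr addrC -lerBrDr ltW.
Qed.

Variable m : {measure set (measurableTypeR R) -> \bar R}.
Hypothesis dm : decreasing_measure m.

(** Outside the segment, the map x |-> (1 - l) x + l a (on the right of a) or
    x |-> (1 - l) x - l a (on the left of -a) sends J into K and moves points
    towards the segment, hence towards the origin.  So each of the two outer
    parts of K has at least 1 - l times the measure of the same part of J, and
    the segment itself is contained in K. *)
Lemma brunn_minkowski_seg (l a : R) J K : 0 < l < 1 -> 0 <= a ->
  measurable J -> measurable K -> seg a `<=` J ->
  (forall x y, `|x| <= a -> J y -> K (l * x + (1 - l) * y)) ->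
  (l%:E * m (seg a) + (1 - l)%:E * m J <= m K)%E.
Proof.
move=> /andP[l0 l1] a0 mJ mK aJ lK.
have mr S b : measurable S ->
    measurable (S `&` [set` Interval b +oo%O] : set (measurableTypeR R)).
  by move=> ?; apply: measurableI => //; exact: measurable_itv.
have ml S b : measurable S ->
    measurable (S `&` [set` Interval -oo%O b] : set (measurableTypeR R)).
  by move=> ?; apply: measurableI => //; exact: measurable_itv.
have split3 S : measurable S -> seg a `<=` S ->
    (m S = m (seg a) + (m (S `&` `]a, +oo[%classic) + m (S `&` `]-oo, (- a)%R[%classic)))%E.
  move=> mS aS; have := measurable_seg a => ma.
  rewrite -measureU; [|exact: mr|exact: ml|]; last first.
    rewrite -subset0 => x /= [] []; rewrite !in_itv /= => _ ? [_ ?]; lra.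
  rewrite -measureU; [|exact: ma|by apply: measurableU; [exact: mr|exact: ml]|].
    congr (m _); apply/seteqP; split=> x /=; rewrite /seg !in_itv /= ler_norml.
      move=> Sx; case: (ltP a x) => xa; first by right; left; rewrite andbT.
      case: (ltP x (- a)) => xa'; first by right; right.
      by left.
    by move=> [ax|[[]|[]]]//; apply: aS; rewrite /seg /= ler_norml.
  rewrite -subset0 => x /= []; rewrite /seg !in_itv /= ler_norml.
  move=> /andP[? ?] [[_ ?]|[_ ?]]; lra.
have aK : seg a `<=` K.
  move=> x xa; have -> : x = l * x + (1 - l) * x by ring.
  by apply: lK; last exact: aJ.
rewrite (split3 K)// (split3 J)//.
rewrite ge0_muleDr ?adde_ge0// addeA -ge0_muleDl ?lee_fin; [|lra|lra].
rewrite -EFinD (_ : l + (1 - l) = 1); last by ring.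
rewrite mul1e leeD2l// ge0_muleDr//.
have l1' : 0 < 1 - l by lra.
apply: leeD.
- apply: (dm (c := l * a)); [exact: l1'|exact: mr|exact: mr|].
  move=> x [Jx]; rewrite /= in_itv /= andbT => ax; split.
    split; last by rewrite in_itv /= andbT; nra.
    by rewrite addrC; apply: lK => //; rewrite ger0_norm.
  rewrite !ger0_norm; nra.
- apply: (dm (c := l * - a)); [exact: l1'|exact: ml|exact: ml|].
  move=> x [Jx]; rewrite /= in_itv /= => ax; split.
    split; last by rewrite in_itv /=; nra.
    by rewrite addrC; apply: lK => //; rewrite normrN ger0_norm.
  rewrite !ler0_norm; nra.
Qed.

Lemma brunn_minkowski_line_sub (l : R) I J K : 0 < l < 1 -> I 0 -> solid1 I ->
  measurable J -> measurable K -> I `<=` J ->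
  (forall x y, I x -> J y -> K (l * x + (1 - l) * y)) ->
  (l%:E * m I + (1 - l)%:E * m J <= m K)%E.
Proof.
move=> l01 I0 sI mJ mK IJ lK.
have [u [u0 ndu uI]] := solid1_exhaust I0 sI.
have segI k : seg (u k) `<=` I.
  by rewrite uI => x xu; exists k.
have step k : (l%:E * m (seg (u k)) + (1 - l)%:E * m J <= m K)%E.
  apply: brunn_minkowski_seg => //; first by have [] := u0 k.
    by move=> x /segI /IJ.
  by move=> x y xu Jy; apply: lK => //; exact: (segI k).
have cvgI : (m \o (seg \o u)) @ \oo --> m I.
  rewrite uI; apply: nondecreasing_cvg_mu.
  - by move=> i; exact: measurable_seg.
  - by apply: bigcupT_measurable => i; exact: measurable_seg.
  - move=> i j ij; apply/subsetPset => x; rewrite /seg /= => /le_trans; apply.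
    exact: ndu.
have cvg2 : (fun k => l%:E * m (seg (u k)) + (1 - l)%:E * m J)%E @ \oo -->
    (l%:E * m I + (1 - l)%:E * m J)%E.
  apply: cvgeD; last exact: cvg_cst.
    by rewrite ge0_adde_def// inE mule_ge0// lee_fin; lra.
  by apply: cvgeZl.
rewrite -(cvg_lim _ cvg2)//; apply: lime_le; first by apply/cvg_ex; eexists; exact: cvg2.
by near=> k; exact: step.
Unshelve. all: by end_near. Qed.

(** Solid sets of the line are totally ordered by inclusion, so one of the two
    contains the other. *)
Lemma brunn_minkowski_line (l : R) I J K : 0 < l < 1 ->
  I 0 -> J 0 -> solid1 I -> solid1 J ->
  measurable I -> measurable J -> measurable K ->
  (forall x y, I x -> J y -> K (l * x + (1 - l) * y)) ->
  (l%:E * m I + (1 - l)%:E * m J <= m K)%E.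
Proof.
move=> l01 I0 J0 sI sJ mI mJ mK lK.
have [IJ|JI] := solid1_total sI sJ; first exact: brunn_minkowski_line_sub.
have -> : l = 1 - (1 - l) by ring.
rewrite addeC (_ : 1 - (1 - (1 - l)) = 1 - l); last by ring.
apply: brunn_minkowski_line_sub => //; first by lra.
move=> x y Jx Iy; rewrite addrC (_ : 1 - (1 - l) = l); last by ring.
exact: lK.
Qed.

End line.

(** * The functional inequality on the line *)

Section layers.
Context (R : realType).
Local Open Scope ereal_scope.
Variable m : {sigma_finite_measure set (measurableTypeR R) -> \bar R}.
Implicit Types f g h : measurableTypeR R -> \bar R.

Let unit_itv : set (measurableTypeR R) := `]0%R, 1%R]%classic.

Lemma measurable_level h (s : R) : measurable_fun setT h ->
  measurable [set x | s%:E <= h x].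
Proof. by move=> mh; rewrite -[X in measurable X]setTI; exact: emeasurable_fun_c_infty. Qed.

Lemma lebesgue_truncation (y : \bar R) : 0 <= y ->
  lebesgue_measure (unit_itv `&` [set s | s%:E <= y]) = mine y 1.
Proof.
move=> y0; pose r : R := fine (mine y 1).
have rE : mine y 1 = r%:E.
  rewrite fineK// ge0_fin_numE ?le_min ?y0 ?lee01//.
  by rewrite gt_min ltry orbT.
have -> : unit_itv `&` [set s | s%:E <= y] = `]0%R, r]%classic.
  apply/seteqP; split=> s; rewrite /unit_itv /= !in_itv /=.
    by move=> [/andP[-> s1] sy]; rewrite -lee_fin -rE le_min sy lee_fin.
  by move=> /andP[->]; rewrite -lee_fin -rE le_min lee_fin => /andP[-> ->].
have r0 : (0 <= r)%R by rewrite -lee_fin -rE le_min y0 lee01.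
rewrite lebesgue_measure_itv /= lte_fin rE; case: ltP => [_|r0'].
  by rewrite oppr0 adde0.
by congr EFin; apply/eqP; rewrite eq_le r0.
Qed.

(** Only the levels up to 1 are needed below, whence the truncation of h: this
    avoids assuming that h is bounded. *)
Lemma layer_cake h : measurable_fun setT h -> (forall x, 0 <= h x) ->
  \int[lebesgue_measure]_(s in unit_itv) m [set x | s%:E <= h x] =
  \int[m]_x mine (h x) 1.
Proof.
move=> mh h0.
pose G : set (measurableTypeR R * measurableTypeR R) :=
  (snd @^-1` unit_itv) `&` [set z | z.2%:E <= h z.1].
have mG : measurable G.
  apply: measurableI.
    rewrite -[X in measurable X]setTI; apply: measurable_snd => //.
    exact: measurable_itv.
  rewrite -[X in measurable X]setTI; apply: measurable_lee => //.
    by apply/measurable_EFinP; exact: measurable_snd.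
  exact: measurableT_comp mh measurable_fst.
have := indic_fubini_tonelli m (@lebesgue_measure R) mG.
rewrite indic_fubini_tonelli_FE// indic_fubini_tonelli_GE// => E.
transitivity (\int[lebesgue_measure]_y (m \o ysection G) y).
  rewrite [LHS]integral_mkcond; apply: eq_integral => s _.
  rewrite patchE /=; case: ifPn => [|]; rewrite ?notin_setE => sU.
    congr (m _); apply/seteqP; split=> x; rewrite /ysection /= inE /G /=.
      by move=> ?; split=> //; exact: set_mem.
    by case.
  rewrite (_ : ysection _ _ = set0) ?measure0// -subset0 => x.
  by rewrite /ysection /= inE /G /= => -[].
rewrite -E; apply: eq_integral => x _ /=.
rewrite -lebesgue_truncation//; congr (lebesgue_measure _).
by apply/seteqP; split=> s; rewrite /xsection /= inE.
Qed.

Hypothesis dm : decreasing_measure m.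

(** For every level s, the superlevel sets of f and g are solid and the
    superlevel set of h / M contains their convex combination; the inequality
    follows by integrating [brunn_minkowski_line] over s.  The origin is added to
    the superlevel sets because they may be empty: f vanishes identically when it
    is the profile of a set of measure zero. *)
Lemma functional_brunn_minkowski (l M : R) f g h : (0 < l < 1)%R -> (0 <= M)%R ->
  measurable_fun setT f -> measurable_fun setT g -> measurable_fun setT h ->
  (forall x, 0 <= f x <= 1) -> (forall x, 0 <= g x <= 1) -> (forall x, 0 <= h x) ->
  (forall x y, (`|x| <= `|y|)%R -> f y <= f x) ->
  (forall x y, (`|x| <= `|y|)%R -> g y <= g x) ->
  (forall (s : R) x y, (0 < s <= 1)%R ->
    (x = 0%R \/ s%:E <= f x) -> (y = 0%R \/ s%:E <= g y) ->
    (M * s)%:E <= h (l * x + (1 - l) * y)%R) ->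
  M%:E * (l%:E * \int[m]_x f x + (1 - l)%:E * \int[m]_x g x) <= \int[m]_x h x.
Proof.
move=> /[dup] l01 /andP[l0 l1] M0 mf mg mh f01 g01 h0 fd gd fgh.
move: M0; rewrite le_eqVlt => /predU1P[<-|M0].
  by rewrite mul0e; apply: integral_ge0.
have layersE k : measurable_fun setT k -> (forall x, 0 <= k x <= 1) ->
    \int[m]_x k x = \int[lebesgue_measure]_(s in unit_itv) m [set x | s%:E <= k x].
  move=> mk k01; rewrite layer_cake//; last by move=> x; have /andP[] := k01 x.
  by apply: eq_integral => x _; rewrite min_l//; have /andP[] := k01 x.
have l0' : (0 <= 1 - l)%R by lra.
have mM : (0 <= M^-1)%R by rewrite invr_ge0 ltW.
suff : l%:E * \int[m]_x f x + (1 - l)%:E * \int[m]_x g x <= \int[m]_x (M^-1%:E * h x).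
  rewrite ge0_integralZl_EFin// => H.
  have -> : \int[m]_x h x = M%:E * (M^-1%:E * \int[m]_x h x).
    by rewrite muleA -EFinM divff ?gt_eqF// mul1e.
  by apply: lee_wpmul2l; rewrite ?lee_fin ?(ltW M0).
have mMh : measurable_fun setT (fun x => M^-1%:E * h x) by exact: measurable_funeM.
have Mh0 x : 0 <= M^-1%:E * h x by rewrite mule_ge0.
apply: (@le_trans _ _ (\int[m]_x mine (M^-1%:E * h x) 1)); last first.
  apply: ge0_le_integral => //.
  - by move=> x _; rewrite le_min Mh0 lee01.
  - by apply: measurable_mine => //; exact: measurable_cst.
  - by move=> x _; rewrite ge_min lexx.
rewrite -layer_cake// (layersE f)// (layersE g)//.
have mlev k : measurable_fun setT k ->
    measurable_fun unit_itv (fun s : measurableTypeR R => m [set x | s%:E <= k x]).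
  move=> mk; apply: measurable_funTS.
  have mG : measurable [set z : measurableTypeR R * measurableTypeR R | z.2%:E <= k z.1].
    rewrite -[X in measurable X]setTI; apply: measurable_lee => //.
      by apply/measurable_EFinP; exact: measurable_snd.
    exact: measurableT_comp mk measurable_fst.
  have := measurable_fun_ysection m mG; apply: eq_measurable_fun => s _ /=.
  by congr (m _); apply/seteqP; split=> x; rewrite /ysection /= inE.
have mU : measurable unit_itv by exact: measurable_itv.
have intZ (c : R) k : measurable_fun setT k -> (0 <= c)%R ->
    c%:E * \int[lebesgue_measure]_(s in unit_itv) m [set x | s%:E <= k x] =
    \int[lebesgue_measure]_(s in unit_itv) (c%:E * m [set x | s%:E <= k x]).
  by move=> mk c0; rewrite ge0_integralZl_EFin//; exact: mlev.
rewrite (intZ l)// ?(ltW l0)// (intZ (1 - l)%R)//.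
rewrite -ge0_integralD//; last 4 first.
- by move=> s _; rewrite mule_ge0// lee_fin ltW.
- by apply: measurable_funeM; exact: mlev.
- by move=> s _; rewrite mule_ge0.
- by apply: measurable_funeM; exact: mlev.
apply: ge0_le_integral => //.
- by move=> s _; rewrite adde_ge0// mule_ge0// lee_fin ltW.
- by apply: emeasurable_funD; apply: measurable_funeM; exact: mlev.
- exact: mlev.
move=> s; rewrite /unit_itv /= in_itv /= => s01.
pose Z k : set (measurableTypeR R) := [set 0%R] `|` [set x | s%:E <= k x].
have mZ k : measurable_fun setT k -> measurable (Z k).
  by move=> mk; apply: measurableU; [exact: measurable_set1|exact: measurable_level].
have sZ k : (forall x y, (`|x| <= `|y|)%R -> k y <= k x) -> solid1 (Z k).
  move=> kd x y yx [x0 | kx]; last by right; exact: le_trans kx (kd _ _ yx).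
  by left; apply/eqP; move: yx; rewrite x0 normr0 normr_le0.
apply: (@le_trans _ _ (l%:E * m (Z f) + (1 - l)%:E * m (Z g))).
  apply: leeD; apply: lee_wpmul2l; rewrite ?lee_fin// ?(ltW l0)//; apply: le_measure;
    rewrite ?inE; by [exact: measurable_level|exact: mZ|move=> x ?; right].
apply: brunn_minkowski_line => //; [by left|by left|exact: sZ|exact: sZ|exact: mZ|exact: mZ| |].
  exact: measurable_level.
move=> x y Zx Zy /=; have -> : s%:E = M^-1%:E * (M * s)%:E.
  by rewrite -EFinM mulrA mulVf ?gt_eqF// mul1r.
apply: lee_wpmul2l; first by rewrite lee_fin.
exact: fgh.
Qed.

End layers.

(** * Product measures on tuples *)

Section cons_measure.
Context (R : realType) (n : nat).
Variable m0 : {sigma_finite_measure set (measurableTypeR R) -> \bar R}.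
Variable m : {sigma_finite_measure set (Rn R n) -> \bar R}.

Definition cons_measure : set (Rn R n.+1) -> \bar R :=
  pushforward (m0 \x m)%E (@Rn_cons R n).

Let cons_measure0 : cons_measure set0 = 0%E.
Proof. by rewrite /cons_measure /pushforward preimage_set0 measure0. Qed.

Let cons_measure_ge0 A : (0 <= cons_measure A)%E.
Proof. exact: (measure_ge0 (m0 \x m)%E). Qed.

Let cons_measure_sigma_additive : semi_sigma_additive cons_measure.
Proof.
pose f : {mfun (measurableTypeR R * Rn R n)%type >-> Rn R n.+1} :=
  HB.pack (@Rn_cons R n) (isMeasurableFun.Build _ _ _ _ _ (@measurable_Rn_cons R n)).
exact: (@measure_semi_sigma_additive _ _ _ (pushforward (m0 \x m)%E f)).
Qed.

HB.instance Definition _ := isMeasure.Build _ _ _ cons_measure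
  cons_measure0 cons_measure_ge0 cons_measure_sigma_additive.

Lemma cons_measureE A : cons_measure A = (\int[m0]_x m [set t | A (Rn_cons (x, t))])%E.
Proof.
rewrite /cons_measure /pushforward; apply: eq_integral => x _ /=.
by congr (m _); apply/seteqP; split=> t; rewrite /xsection /= inE.
Qed.

Let cons_measure_sigma_finite : sigma_finite setT cons_measure.
Proof.
have /sigma_finiteP[F [FT ndF Foo]] := sigma_finiteT m0.
have /sigma_finiteP[G [GT ndG Goo]] := sigma_finiteT m.
pose g (t : Rn R n.+1) : measurableTypeR R * Rn R n :=
  (thead t, [tuple of behead t]).
have gK : cancel (@Rn_cons R n) g by move=> [x t]; congr (_, _); exact/val_inj.
have mg : measurable_fun setT g.
  apply/measurable_fun_pair => /=; first exact: measurable_tnth.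
  exact: measurable_behead.
exists (fun k => g @^-1` (F k `*` G k)).
  apply/esym; rewrite -subTset => t _.
  have [k1 _ Fk1] : (\bigcup_k F k) (g t).1 by rewrite -FT.
  have [k2 _ Gk2] : (\bigcup_k G k) (g t).2 by rewrite -GT.
  exists (maxn k1 k2) => //; split.
    by apply: (subsetPset _ _ (ndF _ _ (leq_maxl k1 k2))).
  by apply: (subsetPset _ _ (ndG _ _ (leq_maxr k1 k2))).
move=> k; have [mF Fk] := Foo k; have [mG Gk] := Goo k; split.
  by rewrite -[X in measurable X]setTI; apply: mg => //; exact: measurableX.
rewrite /cons_measure /pushforward -comp_preimage (_ : g \o _ = id).
  by rewrite preimage_id product_measure1E// lte_mul_pinfty// ge0_fin_numE.
by apply/funext => p; exact: gK.
Qed.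

HB.instance Definition _ := Measure_isSigmaFinite.Build _ _ _ cons_measure
  cons_measure_sigma_finite.

End cons_measure.

(** The first n of the measures m 0, m 1, ... are multiplied.  Indexing by nat
    rather than by 'I_n lets the recursion shift the sequence. *)
Fixpoint prodm (R : realType)
    (m : nat -> {sigma_finite_measure set (measurableTypeR R) -> \bar R}) (n : nat) :
    {sigma_finite_measure set (Rn R n) -> \bar R} :=
  match n with
  | 0 => \d_([tuple] : Rn R 0)
  | n'.+1 => cons_measure (m 0%N) (prodm (fun i => m i.+1) n')
  end.

Section prodm.
Context (R : realType).
Implicit Types m : nat -> {sigma_finite_measure set (measurableTypeR R) -> \bar R}.

Lemma prodmS m n A : prodm m n.+1 A =
  (\int[m 0%N]_x prodm (fun i => m i.+1) n [set t | A (Rn_cons (x, t))])%E.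
Proof. exact: cons_measureE. Qed.

Lemma box_consP n (X : 'I_n.+1 -> set R) x t :
  box X (Rn_cons (x, t)) <-> X ord0 x /\ box (fun i => X (lift ord0 i)) t.
Proof.
have t0 : tnth (Rn_cons (x, t)) ord0 = x by [].
have tS i : tnth (Rn_cons (x, t)) (lift ord0 i) = tnth t i.
  by rewrite /Rn_cons tnthS.
split=> [bX|[X0 bX] i].
  split; first by have := bX ord0; rewrite t0.
  by move=> i; have := bX (lift ord0 i); rewrite tS.
by case: (unliftP ord0 i) => [j ->|->]; rewrite ?tS ?t0.
Qed.

Lemma measurable_box n (X : 'I_n -> set (measurableTypeR R)) :
  (forall i, measurable (X i)) -> measurable (box X).
Proof.
move=> mX; rewrite (_ : box X = \bigcap_i ((tnth (T:=measurableTypeR R))^~ i @^-1` X i)).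
  apply: fin_bigcap_measurable => // i _.
  by rewrite -[X in measurable X]setTI; apply: measurable_tnth.
by apply/seteqP; split=> x h i => [_|]; exact: h.
Qed.

Definition cube n (k : R) : set (Rn R n) := box (fun=> seg k).
Arguments cube n k : clear implicits.

Lemma prodm_box m n (X : 'I_n -> set (measurableTypeR R)) :
  (forall i, measurable (X i)) ->
  (prodm m n (box X) = \prod_(i < n) m i (X i))%E.
Proof.
elim: n m X => [|n IH] m X mX.
  by rewrite big_ord0 /= diracE mem_set// => -[].
rewrite big_ord_recl -(IH (fun i => m i.+1) (fun i => X (lift ord0 i)))//.
rewrite -product_measure1E//; last exact: measurable_box.
rewrite /= /cons_measure /pushforward; congr (_ _); apply/seteqP.
by split=> -[x t] /box_consP.
Qed.

Lemma measurable_cube n (k : R) : measurable (cube n k).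
Proof. by apply: measurable_box => i; exact: measurable_seg. Qed.

Lemma bigcup_cube n : \bigcup_k cube n k%:R = [set: Rn R n].
Proof.
rewrite -subTset => x _; exists (Num.bound (\sum_i `|tnth x i|)) => // i.
rewrite /seg /=; apply/ltW/le_lt_trans/archi_boundP; last exact: sumr_ge0.
by rewrite (bigD1 i)//= lerDl sumr_ge0.
Qed.

Lemma subset_cube n (k1 k2 : R) : k1 <= k2 -> cube n k1 `<=` cube n k2.
Proof. by move=> k12 x xk i; exact: le_trans (xk i) k12. Qed.

Lemma prodm_cube_lty m n (k : R) : (forall i, (m i (seg k) < +oo)%E) ->
  (prodm m n (cube n k) < +oo)%E.
Proof.
move=> mk; rewrite prodm_box; last by move=> i; exact: measurable_seg.
suff /andP[] : (0 <= \prod_(i < n) m i (seg k) < +oo)%E by [].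
apply: (big_ind (fun x : \bar R => is_true (0 <= x < +oo)%E)).
- by rewrite lee01 ltry.
- move=> x y /andP[x0 xoo] /andP[y0 yoo].
  by rewrite mule_ge0//= lte_mul_pinfty// ge0_fin_numE.
- by move=> i _; rewrite measure_ge0 mk.
Qed.

(** Borel boxes form a pi-system that generates the sigma-algebra of R^n, since
    they include the cylinders over one coordinate. *)
Lemma tuple_measure_unique n (m1 m2 : {measure set (Rn R n) -> \bar R}) :
  (forall X : 'I_n -> set (measurableTypeR R), (forall i, measurable (X i)) ->
     m1 (box X) = m2 (box X)) ->
  (forall k : nat, (m1 (cube n k%:R) < +oo)%E) ->
  forall A, measurable A -> m1 A = m2 A.
Proof.
move=> m12 m1oo A mA.
pose G := [set box X | X in [set X : 'I_n -> set (measurableTypeR R) | forall i, measurable (X i)]].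
apply: (@measure_unique _ _ _ G (fun k => cube n k%:R)) => //.
- rewrite eqEsubset; split; last first.
    apply: smallest_sub; first exact: sigma_algebra_measurable.
    by move=> _ [X mX <-]; exact: measurable_box.
  apply: smallest_sub; first exact: smallest_sigma_algebra.
  move=> B; rewrite -bigcup_seq => -[/= i _ [Y mY <-]].
  apply: sub_sigma_algebra; exists (fun j => if j == i then Y else setT).
    by move=> j /=; case: ifP.
  rewrite setTI; apply/seteqP; split=> x.
    by move=> /(_ i); rewrite eqxx.
  by move=> Yx j; case: eqP => // ->.
- move=> _ _ [X mX <-] [Y mY <-]; exists (fun i => X i `&` Y i).
    by move=> i; exact: measurableI.
  apply/seteqP; split=> x.
    by move=> h; split=> i; have [] := h i.
  by move=> [hX hY] i; split; [exact: hX|exact: hY].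
- by move=> k; exists (fun=> seg k%:R) => // i; exact: measurable_seg.
- exact: bigcup_cube.
- by move=> _ [X mX <-]; exact: m12.
Qed.

End prodm.
Arguments cube : clear implicits.

(** * The Brunn-Minkowski inequality for products of decreasing measures *)

Section power_means.
Context (R : realType).
Implicit Types (p x y : R).

Lemma weighted_amgm p x y : 0 <= p <= 1 -> 0 <= x -> 0 <= y ->
  x `^ p * y `^ (1 - p) <= p * x + (1 - p) * y.
Proof.
move=> /andP[]; rewrite le_eqVlt => /predU1P[<- _ x0 y0|p0].
  by rewrite subr0 powRr0 powRr1// !mul1r mul0r add0r.
rewrite le_eqVlt => /predU1P[-> x0 y0|p1 x0 y0].
  by rewrite subrr powRr0 powRr1// mulr1 mul0r mul1r addr0.
have q0 : 0 < 1 - p by rewrite subr_gt0.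
have := @conjugate_powR _ (x `^ p) (y `^ (1 - p)) p^-1 (1 - p)^-1
  (powR_ge0 _ _) (powR_ge0 _ _).
rewrite !invr_gt0 !invrK => /(_ p0 q0); rewrite addrC subrK => /(_ erefl).
by rewrite -!powRrM !divff ?gt_eqF// !powRr1// (mulrC x) (mulrC y).
Qed.

Lemma powRX (x p : R) n : 0 <= x -> (x ^+ n) `^ p = (x `^ p) ^+ n.
Proof. by move=> x0; rewrite -(powR_mulrn n x0) -(powR_mulrn n (powR_ge0 x p)) powRAC. Qed.

End power_means.

Section slices.
Context (R : realType).

Definition solid n (A : set (Rn R n)) := forall x y : Rn R n,
  (forall i, `|tnth y i| <= `|tnth x i|) -> A x -> A y.

Definition slice n (A : set (Rn R n.+1)) (x : R) : set (Rn R n) :=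
  [set t | A (Rn_cons (x, t))].

Lemma measurable_slice n (A : set (Rn R n.+1)) x : measurable A -> measurable (slice A x).
Proof.
move=> mA; rewrite /slice.
have := @measurable_Rn_cons R n measurableT A mA; rewrite setTI.
move=> /(measurable_xsection x); congr measurable.
by apply/seteqP; split=> t; rewrite /xsection /= inE.
Qed.

Lemma measurable_fun_slice n (A : set (Rn R n.+1))
    (nu : {sigma_finite_measure set (Rn R n) -> \bar R}) :
  measurable A -> measurable_fun setT (fun x : measurableTypeR R => nu (slice A x)).
Proof.
move=> mA; have := @measurable_Rn_cons R n measurableT A mA; rewrite setTI.
move=> /(measurable_fun_xsection nu); apply: eq_measurable_fun => x _ /=.
by congr (nu _); apply/seteqP; split=> t; rewrite /xsection /= inE.
Qed.

Lemma tnth_Rn_cons n x (t : Rn R n) (i : 'I_n.+1) :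
  tnth (Rn_cons (x, t)) i = if unlift ord0 i is Some j then tnth t j else x.
Proof.
by case: (unliftP ord0 i) => [j ->|->]; [rewrite /Rn_cons tnthS|].
Qed.

Lemma solid_slice n (A : set (Rn R n.+1)) x : solid A -> solid (slice A x).
Proof.
move=> sA t t' tt'; apply: sA => i; rewrite !tnth_Rn_cons.
by case: (unlift ord0 i).
Qed.

Lemma slice_decreasing n (A : set (Rn R n.+1)) (x y : R) : solid A -> `|x| <= `|y| ->
  slice A y `<=` slice A x.
Proof.
move=> sA xy t; apply: sA => i; rewrite !tnth_Rn_cons.
by case: (unlift ord0 i).
Qed.

Lemma slice_cube n (A : set (Rn R n.+1)) (k x : R) : A `<=` cube R n.+1 k ->
  slice A x `<=` cube R n k.
Proof.
move=> Ak t /Ak /(box_consP (fun=> seg k)) [_ tk] i.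
exact: (tk i).
Qed.

Lemma slice_minkowski n (A B C : set (Rn R n.+1)) (l l' x y : R) :
  minkowski_comb l l' A B `<=` C ->
  minkowski_comb l l' (slice A x) (slice B y) `<=` slice C (l * x + l' * y).
Proof.
move=> ABC _ [a Aa [b Bb <-]]; apply: ABC.
exists (Rn_cons (x, a)) => //; exists (Rn_cons (y, b)) => //.
apply/eq_from_tnth => i; rewrite tnth_Rn_cons tnth_mktuple !tnth_Rn_cons.
by case: (unlift ord0 i) => // j; rewrite tnth_mktuple.
Qed.

Section profile.
Variables (n : nat) (m0 : {sigma_finite_measure set (measurableTypeR R) -> \bar R}).
Variable nu : {sigma_finite_measure set (Rn R n) -> \bar R}.
Variables (k : R) (D : set (Rn R n.+1)).
Hypothesis nuk : (nu (cube R n k) < +oo)%E.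
Hypotheses (mD : measurable D) (sD : solid D) (Dk : D `<=` cube R n.+1 k).
Hypothesis D0 : D !=set0.

(** The largest measure of a slice of a solid set. *)
Definition apex := fine (nu (slice D 0)).

(** If the apex is 0, then so is its inverse, and the profile vanishes. *)
Definition profile (x : measurableTypeR R) : \bar R :=
  (nu (slice D x) * apex^-1%:E)%E.

Let slice_fin x : nu (slice D x) \is a fin_num.
Proof.
rewrite ge0_fin_numE//; apply: le_lt_trans nuk; apply: le_measure; rewrite ?inE.
- exact: measurable_slice.
- exact: measurable_cube.
- exact: slice_cube.
Qed.

Let le_slice (x y : R) : `|x| <= `|y| -> (nu (slice D y) <= nu (slice D x))%E.
Proof.
move=> xy; apply: le_measure; rewrite ?inE; [exact: measurable_slice..|].
exact: slice_decreasing.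
Qed.

Let le_apex x : fine (nu (slice D x)) <= apex.
Proof. by rewrite -lee_fin !fineK//; apply: le_slice; rewrite normr0. Qed.

Lemma apex_ge0 : 0 <= apex.
Proof. exact: fine_ge0. Qed.

Let apexV_ge0 : 0 <= apex^-1.
Proof. by rewrite invr_ge0 apex_ge0. Qed.

Let profileE x : profile x = (fine (nu (slice D x)) / apex)%:E.
Proof. by rewrite EFinM /profile -{1}(fineK (slice_fin x)). Qed.

Lemma measurable_profile : measurable_fun setT profile.
Proof.
apply: emeasurable_funM; first exact: measurable_fun_slice.
exact: measurable_cst.
Qed.

Lemma profile_itv x : (0 <= profile x <= 1)%E.
Proof.
rewrite {1}/profile mule_ge0//= profileE lee_fin.
have [->|an0] := eqVneq apex 0; first by rewrite invr0 mulr0.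
by rewrite ler_pdivrMr ?mul1r// lt_neqAle apex_ge0 eq_sym an0.
Qed.

Lemma profile_decreasing (x y : R) : `|x| <= `|y| -> (profile y <= profile x)%E.
Proof. by move=> xy; apply: lee_wpmul2r; rewrite ?lee_fin//; exact: le_slice. Qed.

Lemma profile_level (s x : R) : 0 < s <= 1 -> x = 0 \/ (s%:E <= profile x)%E ->
  slice D x !=set0 /\ apex * s <= fine (nu (slice D x)).
Proof.
move=> /andP[s0 s1] [->|].
  split; last by rewrite ler_piMr// apex_ge0.
  case: D0 => t; case/tupleP: t => y t Dt; exists t.
  by apply: (slice_decreasing (y := y) sD); rewrite ?normr0.
rewrite profileE lee_fin => sx; have [a0|an0] := eqVneq apex 0.
  by move: sx; rewrite a0 invr0 mulr0 leNgt s0.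
have ap : 0 < apex by rewrite lt_neqAle apex_ge0 eq_sym an0.
split; last by rewrite mulrC -ler_pdivlMr.
apply/set0P/eqP => Dx0; move: sx; rewrite Dx0 measure0 mul0r.
by rewrite leNgt s0.
Qed.

Lemma integral_profile : (cons_measure m0 nu D < +oo)%E ->
  exists2 u : R, 0 <= u & (\int[m0]_x profile x = u%:E)%E /\
    fine (cons_measure m0 nu D) = apex * u.
Proof.
move=> Doo; exists (fine (cons_measure m0 nu D) / apex).
  by rewrite divr_ge0 ?fine_ge0 ?apex_ge0.
split.
  rewrite ge0_integralZr//; last exact: measurable_fun_slice.
  by rewrite -cons_measureE EFinM fineK// ge0_fin_numE.
have [a0|an0] := eqVneq apex 0; last by rewrite mulrC divfK.
(* all slices are null *)
rewrite a0 mul0r cons_measureE (eq_integral (cst 0%E)) ?integral0// => x _ /=.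
rewrite -/(slice D x) -(fineK (slice_fin x)); congr EFin; apply/eqP.
by rewrite eq_le fine_ge0// andbT -a0 le_apex.
Qed.

End profile.
End slices.

Section brunn_minkowski.
Context (R : realType).
Implicit Types m : nat -> {sigma_finite_measure set (measurableTypeR R) -> \bar R}.

(** In the induction step [functional_brunn_minkowski] is applied to the profiles
    of A and of B, with M the bound that the induction hypothesis gives for the
    apices.  If the profiles at x and y are at least s, then the two slices have
    at least s times the measures of the central slices, and the bound for them
    is s M because the exponents p and 1 - p add up to 1.  The hypothesis on c
    then converts the arithmetic mean of the two integrals into a geometric one
    with the same exponents. *)
Lemma brunn_minkowski_powR (l p c : R) : 0 < l < 1 -> 0 <= p <= 1 -> 0 <= c ->
  (forall x y, 0 <= x -> 0 <= y ->
     c * (x `^ p * y `^ (1 - p)) <= l * x + (1 - l) * y) ->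
  forall n m (A B C : set (Rn R n)) (k : R),
  (forall i, decreasing_measure (m i)) ->
  (forall i, (m i (seg k) < +oo)%E) ->
  measurable A -> measurable B -> measurable C ->
  solid A -> solid B -> A `<=` cube R n k -> B `<=` cube R n k ->
  A !=set0 -> B !=set0 -> minkowski_comb l (1 - l) A B `<=` C ->
  ((c ^+ n * (fine (prodm m n A) `^ p * fine (prodm m n B) `^ (1 - p)))%:E
    <= prodm m n C)%E.
Proof.
move=> l01 p01 c0 amc; elim=> [|n IH] m A B C k dm mk mA mB mC sA sB Ak Bk A0 B0 ABC.
  have mem (D : set (Rn R 0)) : D !=set0 -> D [tuple].
    by move=> [x]; rewrite tuple0.
  have C0 : C [tuple].
    by apply: ABC; exists [tuple]; [exact: mem|exists [tuple]; [exact: mem|exact: tuple0]].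
  have one (D : set (Rn R 0)) : D [tuple] -> prodm m 0 D = 1%E.
    by move=> D0; rewrite /= diracE mem_set.
  by rewrite !one//; [rewrite /= !powR1 expr0 !mul1r|exact: mem|exact: mem].
pose m' i := m i.+1; pose nu := prodm m' n.
have nuk : (nu (cube R n k) < +oo)%E by apply: prodm_cube_lty => i; exact: mk.
have oo D : measurable D -> D `<=` cube R n.+1 k -> (prodm m n.+1 D < +oo)%E.
  move=> mD Dk; apply: le_lt_trans (prodm_cube_lty n.+1 mk).
  by apply: le_measure; rewrite ?inE//; exact: measurable_cube.
have l0 : 0 <= l by case/andP: l01 => /ltW.
have l1 : 0 <= 1 - l by case/andP: l01 => _ /ltW; rewrite subr_ge0.
have [u u0 [FAu Au]] := integral_profile nuk mA sA Ak (oo A mA Ak).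
have [v v0 [FBv Bv]] := integral_profile nuk mB sB Bk (oo B mB Bk).
pose al D := apex nu D.
have al0 D : 0 <= al D by exact: apex_ge0.
pose M := c ^+ n * (al A `^ p * al B `^ (1 - p)).
have M0 : 0 <= M by rewrite !mulr_ge0 ?exprn_ge0 ?powR_ge0.
have /andP[p0 p1] := p01.
have p1' : 0 <= 1 - p by rewrite subr_ge0.
apply: (@le_trans _ _ (M%:E * (l%:E * u%:E + (1 - l)%:E * v%:E))%E).
  change ((c ^+ n.+1 * (fine (prodm m n.+1 A) `^ p * fine (prodm m n.+1 B) `^ (1 - p)))%:E
    <= (M * (l * u + (1 - l) * v))%:E)%E.
  rewrite lee_fin Au Bv !powRM ?apex_ge0//.
  rewrite (_ : _ * _ = M * (c * (u `^ p * v `^ (1 - p)))).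
    by rewrite ler_wpM2l// amc.
  by rewrite /M /al exprS; ring.
rewrite -FAu -FBv prodmS.
apply: functional_brunn_minkowski => //.
- exact: measurable_profile.
- exact: measurable_profile.
- exact: measurable_fun_slice.
- exact: (profile_itv nuk).
- exact: (profile_itv nuk).
- exact: profile_decreasing.
- exact: profile_decreasing.
move=> s x y s01 /(profile_level nuk mA sA Ak A0 s01)[Ax0 Axs].
move=> /(profile_level nuk mB sB Bk B0 s01)[Bx0 Bxs].
have /andP[s0 _] := s01.
have := IH m' (slice A x) (slice B y) (slice C (l * x + (1 - l) * y)) k.
move=> /(_ (fun i => dm i.+1) (fun i => mk i.+1)).
move=> /(_ (measurable_slice _ mA) (measurable_slice _ mB) (measurable_slice _ mC)).
move=> /(_ (solid_slice sA) (solid_slice sB) (slice_cube Ak) (slice_cube Bk)).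
move=> /(_ Ax0 Bx0 (slice_minkowski ABC)); apply: le_trans; rewrite lee_fin.
rewrite /M -mulrA ler_wpM2l ?exprn_ge0//.
have sp : s = s `^ p * s `^ (1 - p).
  rewrite -powRD; last by rewrite (gt_eqF s0) implybT.
  by rewrite addrC subrK powRr1// ltW.
rewrite [leLHS](_ : _ = (al A * s) `^ p * (al B * s) `^ (1 - p)); last first.
  by rewrite !powRM ?(ltW s0)// {1}sp; ring.
by apply: ler_pM; rewrite ?powR_ge0//; apply: ge0_ler_powR;
  rewrite ?nnegrE ?mulr_ge0 ?(ltW s0)//; exact: fine_ge0.
Qed.

(** With S = l a + (1 - l) b, the choice p = l a / S, c = S / (a^p b^(1-p))
    satisfies the hypothesis of [brunn_minkowski_powR]: it is the weighted
    arithmetic-geometric inequality for x / a and y / b.  If a or b is 0, then p is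
    0 or 1, and c is 1 - l or l. *)
Lemma brunn_minkowski_bounded n m (A B C : set (Rn R n)) (l k a b : R) :
  0 < l < 1 ->
  (forall i, decreasing_measure (m i)) ->
  (forall i, (m i (seg k) < +oo)%E) ->
  measurable A -> measurable B -> measurable C ->
  solid A -> solid B -> A `<=` cube R n k -> B `<=` cube R n k ->
  A !=set0 -> B !=set0 -> minkowski_comb l (1 - l) A B `<=` C ->
  0 <= a -> 0 <= b -> ((a ^+ n)%:E <= prodm m n A)%E -> ((b ^+ n)%:E <= prodm m n B)%E ->
  (((l * a + (1 - l) * b) ^+ n)%:E <= prodm m n C)%E.
Proof.
move=> /[dup] l01 /andP[l0 l1] dm mk mA mB mC sA sB Ak Bk A0 B0 ABC a0 b0 aA bB.
have fD D : measurable D -> D `<=` cube R n k -> prodm m n D \is a fin_num.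
  move=> mD Dk; rewrite ge0_fin_numE//; apply: le_lt_trans (prodm_cube_lty n mk).
  by apply: le_measure; rewrite ?inE//; exact: measurable_cube.
have l1' : 0 < 1 - l by lra.
set S := l * a + (1 - l) * b.
have S0 : 0 <= S by rewrite /S addr_ge0// mulr_ge0// ltW.
suff [p [c [p01 c0 amc cS]]] : exists p c : R, [/\ 0 <= p <= 1, 0 <= c,
   (forall x y, 0 <= x -> 0 <= y ->
     c * (x `^ p * y `^ (1 - p)) <= l * x + (1 - l) * y) &
   S = c * (a `^ p * b `^ (1 - p))].
  apply: le_trans (brunn_minkowski_powR l01 p01 c0 amc dm mk mA mB mC sA sB Ak Bk A0 B0 ABC).
  rewrite lee_fin cS !exprMn -!powRX//; have /andP[p0 p1] := p01.
  rewrite ler_wpM2l ?exprn_ge0//; apply: ler_pM; rewrite ?powR_ge0//;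
    apply: ge0_ler_powR; rewrite ?nnegrE ?exprn_ge0 ?subr_ge0 ?fine_ge0//.
    by rewrite -lee_fin fineK// fD.
  by rewrite -lee_fin fineK// fD.
have [az|an] := eqVneq a 0.
  exists 0, (1 - l); split; rewrite ?lexx ?ler01 ?(ltW l1')//.
    move=> x y x0 y0; rewrite powRr0 subr0 powRr1// mul1r lerDr.
    by rewrite mulr_ge0// ltW.
  by rewrite /S az powRr0 subr0 powRr1// mulr0 add0r mul1r.
have [bz|bn] := eqVneq b 0.
  exists 1, l; split; rewrite ?lexx ?ler01 ?(ltW l0)//.
    move=> x y x0 y0; rewrite subrr powRr0 powRr1// mulr1 lerDl.
    by rewrite mulr_ge0// ltW.
  by rewrite /S bz subrr powRr0 powRr1// mulr0 addr0 mulr1.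
have ap : 0 < a by rewrite lt_neqAle eq_sym an.
have bp : 0 < b by rewrite lt_neqAle eq_sym bn.
have Sp : 0 < S by rewrite addr_gt0// mulr_gt0.
pose p := l * a / S; pose d := a `^ p * b `^ (1 - p).
have dp : 0 < d by rewrite mulr_gt0// powR_gt0.
have pS : p * S = l * a by rewrite /p divfK ?gt_eqF.
have qS : (1 - p) * S = (1 - l) * b by rewrite mulrBl pS mul1r /S; ring.
exists p, (S / d).
have p01 : 0 <= p <= 1.
  by rewrite /p divr_ge0 ?mulr_ge0 ?(ltW l0)//= ler_pdivrMr// mul1r lerDl mulr_ge0// ltW.
split=> //; first by rewrite divr_ge0// ltW.
- move=> x y x0 y0.
  have -> : S / d * (x `^ p * y `^ (1 - p)) = S * ((x / a) `^ p * (y / b) `^ (1 - p)).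
    rewrite -{1}(divfK an x) -{1}(divfK bn y) !powRM ?divr_ge0 ?invr_ge0//.
    rewrite /d; field.
    by rewrite !gt_eqF// powR_gt0.
  apply: (@le_trans _ _ (S * (p * (x / a) + (1 - p) * (y / b)))).
    by rewrite ler_wpM2l// weighted_amgm// divr_ge0.
  rewrite (_ : _ * _ = p * S * (x / a) + (1 - p) * S * (y / b)); last by ring.
  rewrite pS qS.
  by rewrite (_ : _ + _ = l * x + (1 - l) * y)//; field; rewrite an bn.
- by rewrite divfK// gt_eqF.
Qed.

End brunn_minkowski.

(** * Borel hulls of solid sets *)

Section hulls.
Context (R : realType) (n : nat).
Implicit Types (A B C : set (Rn R n)) (x y : Rn R n) (q : n.-tuple rat).

Lemma countType_bigcup_measurable (I : countType) d (T : sigmaRingType d)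
    (D : set I) (F : I -> set T) :
  (forall i, D i -> measurable (F i)) -> measurable (\bigcup_(i in D) F i).
Proof.
move=> mF; pose G k := if choice.unpickle k is Some i then
  (if i \in D then F i else set0) else set0.
rewrite (_ : \bigcup_(i in D) F i = \bigcup_k G k).
  apply: bigcupT_measurable => k; rewrite /G; case: (choice.unpickle k) => // i.
  by case: ifPn => // /set_mem /mF.
apply/seteqP; split=> [t [i Di Fi]|t [k _]].
  by exists (choice.pickle i) => //; rewrite /G choice.pickleK mem_set.
rewrite /G; case: (choice.unpickle k) => // i; case: ifPn => // /set_mem Di Fi.
by exists i.
Qed.

Definition qpoint q : Rn R n := [tuple ratr (tnth q i) | i < n].

(** The union of the closed symmetric boxes with a rational vertex in A; this is
    a countable union, hence Borel. *)
Definition inner A : set (Rn R n) := \bigcup_(q in [set q | A (qpoint q)])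
  box (fun i => seg `|ratr (tnth q i)|).

(** A point is excluded if it strictly dominates a rational point outside A.  In
    the coordinates where the rational point is 0 no strict domination is
    required: otherwise a point with a zero coordinate would never be excluded,
    and [outer_scale] would fail on the coordinate hyperplanes. *)
Definition outer A : set (Rn R n) := ~` \bigcup_(q in [set q | ~ A (qpoint q)])
  box (fun i => [set t : R | `|ratr (tnth q i)| < `|t| \/ tnth q i = 0]).

Lemma measurable_inner A : measurable (inner A).
Proof.
apply: countType_bigcup_measurable => q _.
by apply: measurable_box => i; exact: measurable_seg.
Qed.

Lemma measurable_outer A : measurable (outer A).
Proof.
apply: measurableC; apply: countType_bigcup_measurable => q _.
apply: measurable_box => i.
have [q0|q0] := pselect (tnth q i = 0).
  rewrite (_ : [set _ | _] = setT)//.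
  by rewrite -subTset => t _; right.
rewrite (_ : [set _ | _] = ~` seg `|ratr (tnth q i)|); last first.
  apply/seteqP; split=> t; rewrite /seg /=.
    by move=> [|//]; rewrite ltNge => /negP.
  by move/negP; rewrite -ltNge; left.
by apply: measurableC; exact: measurable_seg.
Qed.

Lemma inner_sub A : solid A -> inner A `<=` A.
Proof.
move=> sA x [q Aq xq]; apply: sA Aq => i.
by rewrite tnth_mktuple; exact: (xq i).
Qed.

Lemma outer_sup A : solid A -> A `<=` outer A.
Proof.
move=> sA x Ax [q Aq xq]; apply: Aq; apply: sA Ax => i.
rewrite tnth_mktuple; case: (xq i) => [/ltW //|->].
by rewrite raddf0 normr0.
Qed.

Lemma solid_inner A : solid (inner A).
Proof.
move=> x y yx [q Aq xq]; exists q => // i.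
by apply: le_trans (yx i) _; exact: xq.
Qed.

Lemma solid_outer A : solid (outer A).
Proof.
move=> x y yx oAx [q Aq yq]; apply: oAx; exists q => // i.
by case: (yq i) => [lq|]; [left; exact: lt_le_trans (yx i)|right].
Qed.

Lemma inner_nonempty A : solid A -> A !=set0 -> inner A !=set0.
Proof.
move=> sA [x Ax]; exists (qpoint [tuple 0 | i < n]), [tuple 0 | i < n].
  by apply: sA Ax => i; rewrite !tnth_mktuple raddf0 normr0.
by move=> i; rewrite /seg /= !tnth_mktuple raddf0.
Qed.

(** Between t |x_i| and |x_i| there is a rational q_i, unless x_i = 0, where q_i = 0
    serves.  Since x is not excluded by the rational point q, that point is in A,
    and the box with vertex q contains t x. *)
Lemma outer_scale A (t : R) x : 0 < t < 1 -> outer A x ->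
  inner A [tuple t * tnth x i | i < n].
Proof.
move=> /andP[t0 t1] oAx.
have /choice[q qP] (i : 'I_n) : exists q : rat,
    t * `|tnth x i| <= `|ratr q| /\ (`|ratr q| < `|tnth x i| \/ q = 0).
  have [x0|x0] := eqVneq (tnth x i) 0.
    by exists 0; rewrite x0 raddf0 !normr0 mulr0; split; [|right].
  have : t * `|tnth x i| < `|tnth x i| by rewrite gtr_pMl// normr_gt0.
  move=> /rat_in_itvoo[q]; rewrite in_itv /= => /andP[q1 q2].
  have q0 : 0 <= ratr q :> R by apply: le_trans (ltW q1); rewrite mulr_ge0// ltW.
  by exists q; rewrite (ger0_norm q0); split; [exact: ltW|left].
exists [tuple q i | i < n].
  apply: contrapT => nAq; apply: oAx; exists [tuple q i | i < n] => // i.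
  by rewrite /= tnth_mktuple; have [] := qP i.
move=> i; rewrite /seg /= !tnth_mktuple normrM (ger0_norm (ltW t0)).
by have [] := qP i.
Qed.

Lemma solidI A B : solid A -> solid B -> solid (A `&` B).
Proof. by move=> sA sB x y yx [Ax Bx]; split; [exact: sA Ax|exact: sB Bx]. Qed.

Lemma solid_cube (k : R) : solid (cube R n k).
Proof. by move=> x y yx xk i; apply: le_trans (yx i) (xk i). Qed.

Variable m : nat -> {sigma_finite_measure set (measurableTypeR R) -> \bar R}.
Hypothesis dm : forall i, decreasing_measure (m i).
Hypothesis mk : forall i (k : R), (m i (seg k) < +oo)%E.
Hypothesis n0 : (0 < n)%N.

Lemma ex_nth_root (x : \bar R) : (0 <= x < +oo)%E ->
  exists2 a : R, 0 <= a & (a ^+ n)%:E = x.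
Proof.
move=> /andP[x0 xoo]; exists (fine x `^ n%:R^-1); first exact: powR_ge0.
rewrite -powR_mulrn ?powR_ge0// -powRrM mulVf ?pnatr_eq0 ?gtn_eqF//.
by rewrite powRr1 ?fine_ge0// fineK// ge0_fin_numE.
Qed.

Lemma measurable_tuple1 x : measurable [set x].
Proof.
rewrite (_ : [set x] = box (fun i => [set tnth x i])).
  by apply: measurable_box => i; exact: measurable_set1.
by apply/seteqP; split=> [y -> //|y yx]; apply/eq_from_tnth => i; exact: yx.
Qed.

(** By [outer_scale] the inner hull contains t times the outer one, that is
    (1 - t) {0} + t outer; the Brunn-Minkowski inequality for this pair bounds its
    measure from below by t^n times the measure of the outer hull, and t^n takes
    all values r in (0, 1). *)
Lemma prodm_outer_le_inner A (k : R) : 0 <= k -> solid A -> A !=set0 ->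
  (prodm m n (outer A `&` cube R n k) <= prodm m n (inner A `&` cube R n k))%E.
Proof.
move=> k0 sA A0.
have mC : measurable (outer A `&` cube R n k).
  by apply: measurableI; [exact: measurable_outer|exact: measurable_cube].
have mI : measurable (inner A `&` cube R n k).
  by apply: measurableI; [exact: measurable_inner|exact: measurable_cube].
have [|a a0 aE] := ex_nth_root (x := prodm m n (outer A `&` cube R n k)).
  rewrite measure_ge0/=; apply: le_lt_trans (prodm_cube_lty n (m := m) (k := k) _) => //.
  by apply: le_measure; rewrite ?inE//; exact: measurable_cube.
have z0 : cube R n k [tuple 0 | i < n].
  by move=> i; rewrite /seg /= tnth_mktuple normr0.
apply/lee_mul01Pr => // r /andP[r0 r1].
have [|t t0 tE] := ex_nth_root (x := r%:E); first by rewrite lee_fin ltW// ltry.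
move: tE => [tE].
have t01 : 0 < t < 1.
  rewrite lt_neqAle t0 andbT eq_sym; apply/andP; split.
    by apply: contraPneq tE => -> /eqP; rewrite expr0n gtn_eqF//= lt_eqF.
  by rewrite ltNge; apply/negP => /(exprn_ege1 n); rewrite tE leNgt r1.
have t01' : 0 < 1 - t < 1 by lra.
have := @brunn_minkowski_bounded R n m [set [tuple 0 | i < n]]
   (outer A `&` cube R n k) (inner A `&` cube R n k) (1 - t) k 0 a t01' dm (fun i => mk i k).
have -> : 1 - (1 - t) = t by ring.
rewrite mulr0 add0r exprMn expr0n gtn_eqF//= -aE -EFinM tE; apply => //.
- exact: measurable_tuple1.
- move=> x y yx x0; apply/eq_from_tnth => i; rewrite tnth_mktuple; apply/eqP.
  by rewrite -normr_le0; apply: le_trans (yx i) _; rewrite x0 tnth_mktuple normr0.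
- by apply: solidI; [exact: solid_outer|exact: solid_cube].
- by move=> _ ->.
- by eexists.
- case: (inner_nonempty sA A0) => x Ax; exists [tuple 0 | i < n]; split=> //.
  apply: outer_sup => //; apply: inner_sub => //.
  by apply: solid_inner Ax => i; rewrite tnth_mktuple normr0.
- move=> _ [_ -> [y [oAy yk] <-]].
  rewrite (_ : [tuple _ | i < n] = [tuple t * tnth y i | i < n]); last first.
    by apply/eq_from_tnth => i; rewrite !tnth_mktuple mulr0 add0r.
  split; first exact: outer_scale.
  apply: solid_cube yk => i; rewrite tnth_mktuple normrM ler_piMl//.
  by rewrite ger0_norm//; lra.
- by rewrite measure_ge0.
Qed.

Lemma prodm_outerD_inner A : solid A -> A !=set0 -> prodm m n (outer A `\` inner A) = 0%E.
Proof.
move=> sA A0.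
have mo := measurable_outer A; have mi := measurable_inner A.
have mc (k : R) : measurable (cube R n k) by exact: measurable_cube.
apply: measure_negligible; first exact: measurableD.
have -> : outer A `\` inner A =
    \bigcup_k ((outer A `&` cube R n k%:R) `\` (inner A `&` cube R n k%:R)).
  apply/seteqP; split=> [x [ox ix]|x [k _ [[ox xk] nix]]].
    have [k _ xk] : (\bigcup_k cube R n k%:R) x by rewrite bigcup_cube.
    by exists k => //; split=> // -[].
  by split=> // ix; apply: nix.
apply: negligible_bigcup => k; apply/negligibleP.
  by apply: measurableD; exact: measurableI.
have koo : (prodm m n (outer A `&` cube R n k%:R) < +oo)%E.
  apply: le_lt_trans (prodm_cube_lty n (m := m) (k := k%:R) _) => //.
  by apply: le_measure; rewrite ?inE//; exact: measurableI.
rewrite measureD//; [|exact: measurableI|exact: measurableI].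
have sub : inner A `&` cube R n k%:R `<=` outer A `&` cube R n k%:R.
  by move=> x [/(inner_sub sA) /(outer_sup sA) ox xk]; split.
rewrite (setIidr sub); apply/eqP; rewrite eq_le sube_ge0; last first.
  by rewrite [X in _ || X]ge0_fin_numE// koo orbT.
rewrite le_measure ?inE//; [|exact: measurableI|exact: measurableI].
by rewrite andbT sube_le0 prodm_outer_le_inner.
Qed.

Lemma prodm_exhaust A (a : R) : measurable A -> ((a%:E) < prodm m n A)%E ->
  exists k0, forall k, (k0 <= k)%N -> (a%:E <= prodm m n (A `&` cube R n k%:R))%E.
Proof.
move=> mA aA.
have : prodm m n \o (fun k => A `&` cube R n k%:R) @ \oo --> prodm m n A.
  rewrite -[X in _ --> prodm m n X]setIT -bigcup_cube setI_bigcupr.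
  apply: nondecreasing_cvg_mu.
  - by move=> k; apply: measurableI => //; exact: measurable_cube.
  - by apply: bigcupT_measurable => k; apply: measurableI => //; exact: measurable_cube.
  - move=> i j ij; apply/subsetPset; apply: setIS.
    by apply: subset_cube; rewrite ler_nat.
move=> /(_ [set y | (a%:E < y)%E]) [].
  by apply: open_nbhs_nbhs; split => //; exact: open_ereal_gt_ereal.
by move=> k0 _ H; exists k0 => k /H /ltW.
Qed.

(** The alternative a = 0 is there because there is no nonnegative a below X when
    X = 0.  The weights are positive, so that X or Y infinite forces Z infinite. *)
Lemma lee_convex_approx (l : R) (X Y Z : \bar R) : 0 < l < 1 -> (0 <= X)%E -> (0 <= Y)%E ->
  (forall a b : R, 0 <= a -> 0 <= b -> a = 0 \/ (a%:E < X)%E ->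
     b = 0 \/ (b%:E < Y)%E -> ((l * a + (1 - l) * b)%:E <= Z)%E) ->
  (l%:E * X + (1 - l)%:E * Y <= Z)%E.
Proof.
move=> /andP[l0 l1] X0 Y0 H.
have l1' : 0 < 1 - l by lra.
case: Z H => [z| |] H; [|by rewrite leey|]; last first.
  by have := H 0 0 (lexx _) (lexx _) (or_introl erefl) (or_introl erefl).
have fin (c : R) (W : \bar R) : 0 < c -> (0 <= W)%E ->
    (forall a : R, 0 <= a -> a = 0 \/ (a%:E < W)%E -> c * a <= z) ->
    exists2 w, 0 <= w & W = w%:E.
  move=> c0; case: W => [w| |]// w0 h; first by exists w.
  have p0 : 0 <= (`|z| + 1) / c by rewrite divr_ge0// ?addr_ge0// ltW.
  have := h _ p0 (or_intror (ltry _)).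
  by rewrite mulrC divfK ?gt_eqF//; have := ler_norm z; lra.
have [|x x0 XE] := fin l X l0 X0.
  by move=> a a0 aX; have := H a 0 a0 (lexx _) aX (or_introl erefl); rewrite mulr0 addr0 lee_fin.
have [|y y0 YE] := fin (1 - l) Y l1' Y0.
  by move=> b b0 bY; have := H 0 b (lexx _) b0 (or_introl erefl) bY; rewrite mulr0 add0r lee_fin.
rewrite XE YE in H *; rewrite -!EFinM -EFinD lee_fin.
apply/ler_addgt0Pr => e e0.
have approx (w : R) : 0 <= w -> exists2 a : R, 0 <= a & (a = 0 \/ (a%:E < w%:E)%E) /\ w <= a + e.
  move=> w0; have [we|we] := leP w e; first by exists 0 => //; split; [left|lra].
  by exists (w - e); [lra|split; [right; rewrite lte_fin; lra|lra]].
have [a a0 [aX xa]] := approx x x0; have [b b0 [bY yb]] := approx y y0.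
have := H a b a0 b0 aX bY; rewrite lee_fin.
nra.
Qed.

Lemma brunn_minkowski_solid A B C (l : R) : 0 < l < 1 ->
  measurable A -> measurable B -> measurable C -> solid A -> solid B ->
  A !=set0 -> B !=set0 -> minkowski_comb l (1 - l) A B `<=` C ->
  (l%:E * poweR (prodm m n A) n%:R^-1 + (1 - l)%:E * poweR (prodm m n B) n%:R^-1
   <= poweR (prodm m n C) n%:R^-1)%E.
Proof.
move=> l01 mA mB mC sA sB A0 B0 ABC.
have nV0 : 0 <= n%:R^-1 :> R by rewrite invr_ge0.
have rootE (a : R) : 0 <= a -> poweR (a ^+ n)%:E n%:R^-1 = a%:E.
  move=> a0; rewrite poweR_EFin -powR_mulrn// -powRrM divff ?pnatr_eq0 ?gtn_eqF//.
  by rewrite powRr1.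
have inI (x : \bar R) : (0 <= x)%E -> x \in `[0%E, +oo%E].
  by move=> x0; rewrite in_itv /= x0 leey.
have exn0 (a : R) : 0 <= a -> (0 <= (a ^+ n)%:E)%E by move=> ?; rewrite lee_fin exprn_ge0.
have below (D : set (Rn R n)) (a : R) : measurable D -> 0 <= a ->
    a = 0 \/ (a%:E < poweR (prodm m n D) n%:R^-1)%E ->
    exists k0, forall k, (k0 <= k)%N -> ((a ^+ n)%:E <= prodm m n (D `&` cube R n k%:R))%E.
  move=> mD a0 [->|aD].
    by exists 0%N => k _; rewrite expr0n gtn_eqF//= measure_ge0.
  apply: prodm_exhaust => //; rewrite ltNge; apply/negP => Da.
  move: aD; rewrite ltNge => /negP; apply; rewrite -(rootE a)//.
  by apply: (gt0_ler_poweR nV0) => //; apply: inI => //; exact: exn0.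
apply: lee_convex_approx => //; [exact: poweR_ge0|exact: poweR_ge0|].
move=> a b a0 b0 /(below A a mA a0)[ka aA] /(below B b mB b0)[kb bB].
pose k := maxn ka kb.
have := aA k (leq_maxl _ _); have := bB k (leq_maxr _ _) => bBk aAk.
have z0 D : D !=set0 -> solid D -> (D `&` cube R n k%:R) !=set0.
  move=> [x Dx] sD; exists [tuple 0 | i < n]; split.
    by apply: sD Dx => i; rewrite tnth_mktuple normr0.
  by move=> i; rewrite /seg /= tnth_mktuple normr0.
have mI D : measurable D -> measurable (D `&` cube R n k%:R).
  by move=> mD; apply: measurableI => //; exact: measurable_cube.
have sI D : solid D -> solid (D `&` cube R n k%:R).
  by move=> sD; apply: solidI => //; exact: solid_cube.
have ABC' : minkowski_comb l (1 - l) (A `&` cube R n k%:R) (B `&` cube R n k%:R) `<=` C.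
  by move=> _ [x [Ax _] [y [By _] <-]]; apply: ABC; exists x => //; exists y.
have := @brunn_minkowski_bounded R n m _ _ C l k%:R a b l01 dm (fun i => mk i k%:R)
  (mI _ mA) (mI _ mB) mC (sI _ sA) (sI _ sB) (@subIsetr _ _ _) (@subIsetr _ _ _)
  (z0 _ A0 sA) (z0 _ B0 sB) ABC' a0 b0 aAk bBk.
have s0 : 0 <= l * a + (1 - l) * b.
  by case/andP: l01 => l0 l1; rewrite addr_ge0// mulr_ge0//; lra.
move=> H; rewrite -(rootE _ s0); apply: (gt0_ler_poweR nV0) => //; apply: inI => //.
exact: exn0.
Qed.

End hulls.

(** * Affine changes of one variable in Lebesgue measure *)

Section affine_line.
Context (R : realType).

Definition affine (r c : R) : measurableTypeR R -> measurableTypeR R :=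
  fun t => r * t + c.

Lemma measurable_affine (r c : R) : measurable_fun setT (affine r c).
Proof.
apply: measurable_funD; last exact: measurable_cst.
by apply: measurable_funM; [exact: measurable_cst|exact: measurable_id].
Qed.

Lemma lebesgue_affine (r c : R) (A : set (measurableTypeR R)) : 0 < r ->
  measurable A ->
  (r%:E * lebesgue_measure (affine r c @^-1` A) = lebesgue_measure A)%E.
Proof.
move=> r0 mA.
pose s : {nonneg R} := NngNum (ltW r0).
have := @lebesgue_measure_unique R (mscale s (pushforward lebesgue_measure (affine r c))).
move=> /(_ (measurable_affine r c) _ A mA) -> // _ [[a b] /= _ <-].
transitivity (r%:E * lebesgue_measure (affine r c @^-1` `]a, b]%classic))%E; last by [].
have -> : affine r c @^-1` `]a, b]%classic = `](a - c) / r, (b - c) / r]%classic.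
  apply/seteqP; split=> t; rewrite /= /affine !in_itv /= ltr_pdivrMr// ler_pdivlMr//;
    by rewrite ltrBlDr lerBrDr (mulrC t).
rewrite !lebesgue_measure_itv /= !lte_fin ltr_pM2r ?invr_gt0// ltrD2r.
case: ifPn => ab; last by rewrite mule0.
rewrite -!EFinB -EFinM; congr EFin; field.
by rewrite gt_eqF.
Qed.

Lemma decreasing_lebesgue : decreasing_measure (@lebesgue_measure R).
Proof.
move=> r c E D r0 mE mD ED; rewrite -(lebesgue_affine c r0 mD).
apply: lee_wpmul2l; first by rewrite lee_fin ltW.
apply: le_measure; rewrite ?inE//.
  by rewrite -[X in measurable X]setTI; exact: measurable_affine.
by move=> t /ED[].
Qed.

Lemma lebesgue_seg_lty (k : R) : (lebesgue_measure (seg k) < +oo)%E.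
Proof. by rewrite segE lebesgue_measure_itv /=; case: ifP => _; rewrite ?ltry. Qed.

End affine_line.

Section affine_space.
Context (R : realType) (n : nat).
Notation L := (lebesgue_Rn R n).
Notation bl := (borel_lebesgue R n).

Lemma borel_lebesgueE k A : borel_lebesgue R k A = prodm (fun=> lebesgue_measure) k A.
Proof.
elim: k A => // k IH A; apply: eq_integral => x _ /=.
exact: IH.
Qed.

Lemma lebesgue_RnE (A : set (Rn R n)) : measurable A -> L A = bl A.
Proof. exact: measurable_mu_extE. Qed.

Lemma borel_Rn_lebesgue (A : set (Rn R n)) :
  measurable A -> measurable (A : set (Rn_lebesgue R n)).
Proof. exact: caratheodory_measurable_mu_ext. Qed.

Definition aff_coord (i : 'I_n) (r c : R) (x : Rn R n) : Rn R n :=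
  [tuple if j == i then r * tnth x j + c else tnth x j | j < n].

Lemma aff_coordK i r c : r != 0 ->
  cancel (aff_coord i r c) (aff_coord i r^-1 (- (c / r))).
Proof.
move=> r0 x; apply/eq_from_tnth => j; rewrite !tnth_mktuple.
by case: eqP => // _; field.
Qed.

Lemma aff_coordVK i r c : r != 0 ->
  cancel (aff_coord i r^-1 (- (c / r))) (aff_coord i r c).
Proof.
move=> r0 x; apply/eq_from_tnth => j; rewrite !tnth_mktuple.
by case: eqP => // _; field.
Qed.

Lemma measurable_aff_coord i r c : measurable_fun setT (aff_coord i r c).
Proof.
apply/measurable_fun_tnthP => j.
apply: (@eq_measurable_fun _ _ _ _ _ (fun x : Rn R n =>
   if j == i then r * tnth x j + c else tnth x j)).
  by move=> x _ /=; rewrite tnth_mktuple.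
case: eqP => _; last exact: measurable_tnth.
by apply: measurableT_comp (measurable_affine r c) _; exact: measurable_tnth.
Qed.

Lemma borel_lebesgue_aff i (r c : R) (A : set (Rn R n)) : 0 < r -> measurable A ->
  (r%:E * bl (aff_coord i r c @^-1` A) = bl A)%E.
Proof.
move=> r0 mA.
pose s : {nonneg R} := NngNum (ltW r0).
apply/esym; apply: (@tuple_measure_unique R n bl (mscale s (pushforward bl (aff_coord i r c)))) => //.
  exact: measurable_aff_coord.
  move=> ? X mX; transitivity (r%:E * bl (aff_coord i r c @^-1` box X))%E; last by [].
  pose Y j := if j == i then affine r c @^-1` X j else X j.
  have mY j : measurable (Y j : set (measurableTypeR R)).
    rewrite /Y; case: ifP => // _; rewrite -[X in measurable X]setTI.
    exact: measurable_affine.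
  rewrite (_ : aff_coord i r c @^-1` box X = box Y); last first.
    apply/seteqP; split=> x h j; have := h j; rewrite /Y /= tnth_mktuple; by case: ifP.
  transitivity (prodm (fun=> lebesgue_measure) n (box X)); first exact: borel_lebesgueE.
  rewrite borel_lebesgueE !prodm_box//.
  rewrite (bigD1 i)//= [in RHS](bigD1 i)//= muleA; congr (_ * _)%E.
    by rewrite /Y eqxx lebesgue_affine.
  by apply: eq_bigr => j /negPf ji; rewrite /Y ji.
move=> k.
suff : (prodm (fun=> lebesgue_measure) n (cube R n k%:R) < +oo)%E.
  by rewrite -borel_lebesgueE.
by apply: prodm_cube_lty => _; exact: lebesgue_seg_lty.
Qed.

(** Pulling back a countable Borel cover of A gives a cover of the preimage of A;
    this handles sets A that are not Borel, and even not measurable, which is what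
    the Caratheodory criterion requires. *)
Lemma lebesgue_aff_le i (r c : R) (A : set (Rn R n)) : 0 < r ->
  (r%:E * L (aff_coord i r c @^-1` A) <= L A)%E.
Proof.
move=> r0; apply: le_ereal_inf_tmp => _ [F [mF AF] <-].
pose G k := aff_coord i r c @^-1` F k.
have mG k : measurable (G k).
  by rewrite -[X in measurable X]setTI; exact: measurable_aff_coord.
rewrite (eq_eseriesr (g := fun k => (r%:E * bl (G k))%E)); last first.
  by move=> k _; rewrite borel_lebesgue_aff.
rewrite nneseriesZl; last by [].
apply: lee_wpmul2l; first by rewrite lee_fin ltW.
have H : L (aff_coord i r c @^-1` A) = mu_ext bl (aff_coord i r c @^-1` A) by [].
rewrite H.
apply: ereal_inf_lbound; exists G => //; split=> // x /AF [k _ Fk].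
by exists k.
Qed.

Lemma lebesgue_aff i (r c : R) (A : set (Rn R n)) : 0 < r ->
  (r%:E * L (aff_coord i r c @^-1` A) = L A)%E.
Proof.
move=> r0; apply/eqP; rewrite eq_le lebesgue_aff_le//=.
have rV0 : 0 < r^-1 by rewrite invr_gt0.
have := @lebesgue_aff_le i r^-1 (- (c / r)) (aff_coord i r c @^-1` A) rV0.
rewrite -comp_preimage (_ : _ \o _ = id); last first.
  by apply/funext => x; rewrite /= aff_coordVK// gt_eqF.
rewrite preimage_id => H.
apply: le_trans (lee_wpmul2l (x := r%:E) _ H); last by rewrite lee_fin ltW.
by rewrite muleA -EFinM divff ?gt_eqF// mul1e.
Qed.

Lemma measurable_lebesgue_aff i (r c : R) : 0 < r ->
  measurable_fun setT (aff_coord i r c : Rn_lebesgue R n -> Rn_lebesgue R n).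
Proof.
move=> r0 _ A mA; rewrite setTI.
suff : caratheodory_measurable (mu_ext bl) (aff_coord i r c @^-1` A) by [].
move=> X.
have key Y : L (aff_coord i r c @^-1` Y) = (r^-1%:E * L Y)%E.
  by rewrite -(lebesgue_aff i c Y r0) muleA -EFinM mulVf ?gt_eqF// mul1e.
pose Y := aff_coord i r^-1 (- (c / r)) @^-1` X.
have -> : X = aff_coord i r c @^-1` Y.
  by rewrite /Y -comp_preimage (_ : _ \o _ = id)//; apply/funext => x; rewrite /= aff_coordK// gt_eqF.
have := mA Y; change (L Y = L (Y `&` A) + L (Y `&` ~` A) ->
  L (aff_coord i r c @^-1` Y) = L (aff_coord i r c @^-1` (Y `&` A)) +
    L (aff_coord i r c @^-1` (Y `&` ~` A)))%E.
by rewrite !key -ge0_muleDr// => ->.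
Qed.

Lemma integral_lebesgue_aff i (r c : R) (D : set (Rn_lebesgue R n))
    (f : Rn_lebesgue R n -> \bar R) : 0 < r ->
  measurable D -> measurable_fun D f -> (forall x, 0 <= f x)%E ->
  (\int[L]_(x in D) f x =
   r%:E * \int[L]_(x in aff_coord i r c @^-1` D) f (aff_coord i r c x))%E.
Proof.
move=> r0 mD mf f0.
pose g : Rn_lebesgue R n -> Rn_lebesgue R n := aff_coord i r c.
have mg : measurable_fun setT g by exact: measurable_lebesgue_aff.
pose s : {nonneg R} := NngNum (ltW r0).
rewrite (eq_measure_integral (mscale s (pushforward L g))); last first.
  move=> *. apply/esym. exact: lebesgue_aff.
rewrite ge0_integral_mscale; [|exact: mD|exact: mf|by move=> x _; exact: f0].
by rewrite ge0_integral_pushforward//; exact: measurable_lebesgue_aff.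
Qed.

End affine_space.

(** * Ideals and densities as solid objects *)

Section ideals_are_solid.
Context (R : realType) (n : nat).
Implicit Types (x y : Rn R n) (A B : set (Rn R n)).

(** Pass from |x| to |y| by changing one coordinate at a time. *)
Lemma decreasing_abs (f : Rn R n -> R) x y : unconditional f -> coord_decreasing f ->
  (forall i, `|tnth y i| <= `|tnth x i|) -> f x <= f y.
Proof.
move=> uf df yx.
have fabs z : f [tuple `|tnth z i| | i < n] = f z.
  rewrite -(uf z (fun i => if 0 <= tnth z i then 1 else -1)); last first.
    by move=> i; case: ifP; [left|right].
  congr f; apply/eq_from_tnth => i; rewrite !tnth_mktuple.
  by case: ifPn => [/ger0_norm ->|]; [rewrite mul1r|rewrite -ltNge mulN1r => /ltr0_norm].
(* the first k coordinates have already been changed *)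
pose mix k : Rn R n := [tuple if (j < k)%N then `|tnth y j| else `|tnth x j| | j < n].
have step k : f (mix k) <= f (mix k.+1).
  have [kn|nk] := ltnP k n; last first.
    rewrite (_ : mix k.+1 = mix k)//; apply/eq_from_tnth => j; rewrite !tnth_mktuple.
    by have jk := leq_trans (ltn_ord j) nk; rewrite jk (leq_trans jk).
  pose i := Ordinal kn.
  have -> : mix k = set_coord (mix k) i `|tnth x i|.
    apply/eq_from_tnth => j; rewrite !tnth_mktuple.
    by case: eqP => [->|//]; rewrite /= ltnn.
  have -> : mix k.+1 = set_coord (mix k) i `|tnth y i|.
    apply/eq_from_tnth => j; rewrite !tnth_mktuple ltnS leq_eqVlt -val_eqE /=.
    by case: eqP => [ji|//]; congr (`|tnth y _|); exact/val_inj.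
  exact: df.
have mix0 : mix 0 = [tuple `|tnth x i| | i < n].
  by apply/eq_from_tnth => j; rewrite !tnth_mktuple.
have mixn : mix n = [tuple `|tnth y i| | i < n].
  by apply/eq_from_tnth => j; rewrite !tnth_mktuple ltn_ord.
rewrite -(fabs x) -(fabs y) -mix0 -mixn.
have le_mix k : f (mix 0) <= f (mix k) by elim: k => // k /le_trans; apply.
exact: le_mix.
Qed.

Lemma ideal_solid A : is_ideal A -> solid A.
Proof.
move=> [uA dA] x y yx Ax; apply: contrapT => nAy.
have := decreasing_abs uA dA yx.
by rewrite !indicE mem_set// memNset// ler10.
Qed.

(** If y is dominated by x = s a + t b, then y_i = d_i x_i with |d_i| <= 1, and the
    same factors may be applied to a and b. *)
Lemma solid_minkowski (s t : R) A B : solid A -> solid B -> solid (minkowski_comb s t A B).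
Proof.
move=> sA sB x y yx [a Aa [b Bb xE]].
pose d i := tnth y i / tnth x i.
have d1 i : `|d i| <= 1.
  have [x0|x0] := eqVneq (tnth x i) 0; first by rewrite /d x0 invr0 mulr0 normr0.
  by rewrite normrM normfV ler_pdivrMr ?normr_gt0// mul1r.
have dx i : d i * tnth x i = tnth y i.
  have [x0|x0] := eqVneq (tnth x i) 0; last by rewrite divfK.
  by have := yx i; rewrite x0 mulr0 normr0 normr_le0 => /eqP ->.
exists [tuple d i * tnth a i | i < n].
  by apply: sA Aa => i; rewrite tnth_mktuple normrM ler_piMl.
exists [tuple d i * tnth b i | i < n].
  by apply: sB Bb => i; rewrite tnth_mktuple normrM ler_piMl.
by apply/eq_from_tnth => i; rewrite !tnth_mktuple -dx -xE tnth_mktuple; ring.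
Qed.

(** The set differs from its inner hull by a subset of the difference of the two
    hulls, which is a null set because Lebesgue measure itself is a product of
    decreasing measures. *)
Lemma solid_Rn_measurable A : (0 < n)%N -> solid A -> A !=set0 ->
  measurable (A : set (Rn_lebesgue R n)).
Proof.
move=> n0 sA A0.
have mi := borel_Rn_lebesgue (measurable_inner A).
have -> : A = inner A `|` (A `\` inner A).
  by rewrite setDUK//; exact: inner_sub.
apply: measurableU => //.
apply: (@measure_is_complete_caratheodory R (Rn R n) (mu_ext (borel_lebesgue R n))).
have mD : measurable (outer A `\` inner A).
  by apply: measurableD; [exact: measurable_outer|exact: measurable_inner].
exists (outer A `\` inner A); split.
- exact: borel_Rn_lebesgue.
- have := @prodm_outerD_inner R n (fun=> lebesgue_measure) (fun=> @decreasing_lebesgue R)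
    (fun _ => @lebesgue_seg_lty R) n0 A sA A0.
  by rewrite -borel_lebesgueE => <-; exact: lebesgue_RnE.
- by apply: setSD; exact: outer_sup.
Qed.

End ideals_are_solid.

(** * Marginals of a product measure with a decreasing density *)

Section marginals.
Context (R : realType) (n : nat).
Variables (mu : {measure set (Rn_lebesgue R n) -> \bar R})
  (m : 'I_n -> {measure set (measurableTypeR R) -> \bar R})
  (phi : Rn_lebesgue R n -> R).
Hypothesis mum : is_product_measure mu m.
Hypothesis muphi : has_density mu phi.
Hypothesis phi_dec : forall x y : Rn R n,
  (forall i, `|tnth y i| <= `|tnth x i|) -> phi x <= phi y.

Let mphi D : measurable_fun D (fun x => (phi x)%:E).
Proof. by apply: measurable_funTS; apply/measurable_EFinP; case: muphi. Qed.

Let phi0 x : (0 <= (phi x)%:E)%E.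
Proof. by rewrite lee_fin; case: muphi. Qed.

(** On the cube the density is at most its value at the origin. *)
Lemma density_cube_lty (k : R) : (mu (cube R n k) < +oo)%E.
Proof.
have mc : measurable (cube R n k : set (Rn_lebesgue R n)).
  by apply: borel_Rn_lebesgue; exact: measurable_cube.
case: muphi => _ _ ->//.
pose z : Rn R n := [tuple 0 | i < n].
apply: (@le_lt_trans _ _ (\int[lebesgue_Rn R n]_(x in cube R n k) (cst (phi z)%:E x))%E).
  apply: ge0_le_integral; [exact: mc|by move=> *; exact: phi0|exact: mphi
    |exact: measurable_cst|].
  by move=> x _; rewrite lee_fin; apply: phi_dec => i; rewrite tnth_mktuple normr0.
rewrite integral_cst// lte_mul_pinfty//.
suff : (lebesgue_Rn R n (cube R n k) < +oo)%E by [].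
have -> : lebesgue_Rn R n (cube R n k) = prodm (fun=> lebesgue_measure) n (cube R n k).
  by rewrite -borel_lebesgueE; apply: lebesgue_RnE; exact: measurable_cube.
by apply: prodm_cube_lty => _; exact: lebesgue_seg_lty.
Qed.

(** The change of variable x_i |-> r x_i + c turns the integral over D into r times
    an integral over a set containing E, and the density does not decrease at the
    points that are moved towards the origin in that coordinate. *)
Lemma density_contraction i (r c : R) (E D : set (Rn R n)) : 0 < r ->
  measurable E -> measurable D ->
  (forall x, E x -> D (aff_coord i r c x) /\ `|r * tnth x i + c| <= `|tnth x i|) ->
  (r%:E * mu E <= mu D)%E.
Proof.
move=> r0 /borel_Rn_lebesgue mE /borel_Rn_lebesgue mD ED.
have [_ _ muE] := muphi; rewrite !muE// [leRHS](integral_lebesgue_aff i c r0 mD (@mphi D) phi0)//.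
apply: lee_wpmul2l; first by rewrite lee_fin ltW.
have ma := measurable_lebesgue_aff i c r0.
have mp : measurable_fun setT (fun x : Rn_lebesgue R n => (phi (aff_coord i r c x))%:E).
  by apply/measurable_EFinP; apply: measurableT_comp ma; case: muphi.
have mDa : measurable (aff_coord i r c @^-1` D : set (Rn_lebesgue R n)).
  by rewrite -[X in measurable X]setTI; exact: ma.
apply: (@le_trans _ _ (\int[lebesgue_Rn R n]_(x in E) (phi (aff_coord i r c x))%:E)%E).
  apply: ge0_le_integral; [exact: mE|by move=> *; exact: phi0|exact: mphi
    |exact: measurable_funTS|].
  move=> x Ex; rewrite lee_fin; apply: phi_dec => j; rewrite tnth_mktuple.
  by case: eqP => // ->; have [] := ED x Ex.
apply: ge0_subset_integral; [exact: mE|exact: mDa|exact: measurable_funTS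
  |by move=> *; exact: phi0|].
by move=> x /ED[].
Qed.

Variable N : R.
Hypothesis muN : mu (cube R n N) != 0%E.

Let slab i (S : set (measurableTypeR R)) : set (Rn R n) :=
  box (fun j => if j == i then S else seg N).

Let kap i := (\prod_(j < n | j != i) m j (seg N))%E.

Let measurable_slab i S : measurable S -> measurable (slab i S).
Proof.
move=> mS; apply: measurable_box => j; case: ifP => // _; exact: measurable_seg.
Qed.

Let slabE i S : measurable S -> mu (slab i S) = (m i S * kap i)%E.
Proof.
move=> mS; rewrite /slab mum; last first.
  by move=> j; case: ifP => // _; exact: measurable_seg.
rewrite (bigD1 i)//= eqxx; congr (_ * _)%E; apply: eq_bigr => j /negPf ->.
by [].
Qed.

(** The cube has finite nonzero measure, so that every factor of the product is
    finite and nonzero: one can divide by the product of the other factors to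
    recover a marginal from the measure of slabs. *)
Let kapE i : exists2 k : R, 0 < k & kap i = k%:E.
Proof.
have cubeE : mu (cube R n N) = (m i (seg N) * kap i)%E.
  rewrite -slabE; last exact: measurable_seg.
  by congr (mu _); apply/seteqP; split=> x h j; have := h j; case: ifP.
have k0 : (0 <= kap i)%E by apply: prode_ge0 => j _.
have := density_cube_lty N; move: muN; rewrite cubeE; move: k0.
case: (kap i) => [k| |]//.
  rewrite lee_fin le_eqVlt => /predU1P[<-|k0 _ _]; last by exists k.
  by rewrite mule0 eqxx.
move=> _; have [->|m0] := eqVneq (m i (seg N)) 0%E; first by rewrite mul0e eqxx.
by rewrite gt0_muley ?ltxx// lt_neqAle eq_sym m0 measure_ge0.
Qed.

Lemma marginal_decreasing i : decreasing_measure (m i).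
Proof.
move=> r c E D r0 mE mD ED; have [k k0 kE] := kapE i.
rewrite -(@lee_pmul2r _ k%:E) ?lte_fin//.
rewrite -kE -muleA -!slabE//.
apply: (density_contraction (i := i) (c := c)); [exact: r0|exact: measurable_slab..|].
move=> x xE; have /ED[Dx xc] : E (tnth x i) by have := xE i; rewrite eqxx.
split=> // j; rewrite tnth_mktuple; case: eqP => [->//|/eqP/negPf ji].
by have := xE j; rewrite ji.
Qed.

Lemma marginal_lty i (k : R) : (m i (seg k) < +oo)%E.
Proof.
have [kk k0 kE] := kapE i.
have : (mu (slab i (seg k)) < +oo)%E.
  apply: le_lt_trans (density_cube_lty (Num.max k N)).
  apply: le_measure; rewrite ?inE.
  - by apply: borel_Rn_lebesgue; apply: measurable_slab; exact: measurable_seg.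
  - by apply: borel_Rn_lebesgue; exact: measurable_cube.
  - move=> x xs j; have := xs j; rewrite /seg /= le_max.
    by case: ifP => _ ->; rewrite ?orbT.
rewrite slabE; last exact: measurable_seg.
by rewrite kE; case: (m i (seg k)) => [w| |]; rewrite ?ltry// gt0_mulye ?lte_fin.
Qed.

End marginals.

(** Iterated products are defined for measures with a sigma-finite structure; a
    measure that is finite on segments is given that structure here. *)
Section sigma_finite_pack.
Context (R : realType) (nu : {measure set (measurableTypeR R) -> \bar R}).
Hypothesis nuk : forall k : R, (nu (seg k) < +oo)%E.

Definition locally_finite : set (measurableTypeR R) -> \bar R := nu.

HB.instance Definition _ := Measure.on locally_finite.

Let locally_finite_sigma_finite : sigma_finite setT locally_finite.
Proof.
exists (fun k : nat => seg k%:R); last by move=> k; split; [exact: measurable_seg|exact: nuk].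
apply/esym; rewrite -subTset => x _; exists (Num.bound `|x|) => //.
by rewrite /seg /=; apply/ltW; exact: archi_boundP.
Qed.

HB.instance Definition _ := Measure_isSigmaFinite.Build _ _ _ locally_finite
  locally_finite_sigma_finite.

Lemma sigma_finite_pack :
  exists nu' : {sigma_finite_measure set (measurableTypeR R) -> \bar R},
    forall A, nu' A = nu A.
Proof. by exists locally_finite. Qed.

End sigma_finite_pack.

(** The marginals are indexed by 'I_n and a sequence is needed; inord extends the
    family beyond n by one of its members. *)
Lemma density_prodm (R : realType) (n : nat)
    (mu : {measure set (Rn_lebesgue R n) -> \bar R}) (N : R) : (0 < n)%N ->
  unconditional_product_measure_decreasing_density mu ->
  mu (cube R n N) != 0%E ->
  exists mm : nat -> {sigma_finite_measure set (measurableTypeR R) -> \bar R},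
  [/\ forall i, decreasing_measure (mm i),
      forall i (k : R), (mm i (seg k) < +oo)%E &
      forall A : set (Rn R n), measurable A -> mu A = prodm mm n A].
Proof.
case: n mu => // n mu _ [[m mum] [phi [muphi uphi dphi]]] muN.
have phi_dec := fun x y => decreasing_abs (x := x) (y := y) uphi dphi.
have mdec := marginal_decreasing mum muphi phi_dec muN.
have mlty := marginal_lty mum muphi phi_dec muN.
have /choice[m' m'E] i := sigma_finite_pack (mlty i).
pose mm k := m' (inord k : 'I_n.+1).
exists mm; split.
- by move=> i r c E D r0 mE mD ED; rewrite /mm !m'E; exact: mdec ED.
- by move=> i k; rewrite /mm m'E.
move=> A mA.
pose f (x : Rn_lebesgue R n.+1) : Rn R n.+1 := x.
have mf : measurable_fun setT f.
  by move=> _ B mB; rewrite setTI; exact: borel_Rn_lebesgue.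
apply: (@tuple_measure_unique R n.+1 (pushforward mu f) (prodm mm n.+1)) => //.
  move=> X mX; transitivity (mu (box X)); first by [].
  apply: etrans (esym (prodm_box _ mX)).
  rewrite mum//; apply: eq_bigr => i _.
  by rewrite /mm inord_val m'E.
by move=> k; exact: (density_cube_lty muphi phi_dec).
Qed.

(** * The theorem *)

Theorem theorem1 (R : realType) (n : nat) (hn : (1 <= n)%N)
    (mu : {measure set (Rn_lebesgue R n) -> \bar R})
    (hmu : unconditional_product_measure_decreasing_density mu)
    (A B : set (Rn R n)) (A0 : A !=set0) (B0 : B !=set0)
    (hA : is_ideal A) (hB : is_ideal B)
    (lambda : R) (h0 : 0 <= lambda) (h1 : lambda <= 1) :
  (lambda%:E * poweR (mu A) n%:R^-1 + (1 - lambda)%:E * poweR (mu B) n%:R^-1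
   <= poweR (mu (minkowski_comb lambda (1 - lambda) A B)) n%:R^-1)%E.
Proof.
have sA := ideal_solid hA; have sB := ideal_solid hB.
have [a Aa] := A0; have [b Bb] := B0.
move: h0; rewrite le_eqVlt => /predU1P[<-|l0].
  rewrite (_ : minkowski_comb _ _ A B = B).
    by rewrite mul0e add0e subr0 mul1e.
  have comb (x y : Rn R n) : [tuple 0 * tnth x i + (1 - 0) * tnth y i | i < n] = y.
    by apply/eq_from_tnth => i; rewrite tnth_mktuple subr0 mul0r add0r mul1r.
  apply/seteqP; split=> [_ [x _ [y By <-]]|y By]; first by rewrite comb.
  by exists a => //; exists y.
move: h1; rewrite le_eqVlt => /predU1P[->|l1].
  rewrite (_ : minkowski_comb _ _ A B = A).
    by rewrite subrr mul0e adde0 mul1e.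
  have comb (x y : Rn R n) : [tuple 1 * tnth x i + (1 - 1) * tnth y i | i < n] = x.
    by apply/eq_from_tnth => i; rewrite tnth_mktuple subrr mul0r addr0 mul1r.
  apply/seteqP; split=> [_ [x Ax [y _ <-]]|x Ax]; first by rewrite comb.
  by exists x => //; exists b.
have l01 : 0 < lambda < 1 by rewrite l0.
set C := minkowski_comb _ _ A B.
have sC : solid C by exact: solid_minkowski.
have C0 : C !=set0 by eexists; exists a => //; exists b.
have mA := solid_Rn_measurable hn sA A0.
have mB := solid_Rn_measurable hn sB B0.
have mC := solid_Rn_measurable hn sC C0.
(* if all cubes are null, then mu = 0 and both sides vanish *)
have [muz|/existsNP[N /eqP muN]] := pselect (forall k : nat, mu (cube R n k%:R) = 0%E).
  have muT : mu setT = 0%E.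
    rewrite -(bigcup_cube R n); apply: measure_negligible.
      apply: bigcupT_measurable => k; apply: borel_Rn_lebesgue.
      exact: measurable_cube.
    apply: negligible_bigcup => k; apply/negligibleP; last exact: muz.
    by apply: borel_Rn_lebesgue; exact: measurable_cube.
  have mu0 D : measurable D -> mu D = 0%E.
    move=> mD; apply/eqP; rewrite -measure_le0 -muT; apply: le_measure; rewrite ?inE//.
  rewrite !mu0// poweR0r ?invr_eq0 ?pnatr_eq0 ?gtn_eqF// !mule0 adde0.
  by [].
have [m [dm mk muE]] := density_prodm hn hmu muN.
have hull D : solid D -> D !=set0 -> measurable (D : set (Rn_lebesgue R n)) ->
    mu D = prodm m n (inner D) /\ mu D = prodm m n (outer D).
  move=> sD D0 mD.
  have mi := measurable_inner D; have mo := measurable_outer D.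
  have io : prodm m n (outer D) = prodm m n (inner D).
    have -> : outer D = inner D `|` (outer D `\` inner D).
      by rewrite setDUK// => x /(inner_sub sD)/(outer_sup sD).
    transitivity (prodm m n (inner D) + prodm m n (outer D `\` inner D))%E.
      by apply: measureU; [|exact: measurableD|rewrite setDIK].
    by rewrite prodm_outerD_inner// adde0.
  suff E : mu D = prodm m n (inner D) by rewrite io.
  apply/eqP; rewrite eq_le -{1}io -!muE//; apply/andP; split;
    apply: le_measure; rewrite ?inE//; try exact: borel_Rn_lebesgue.
  - exact: outer_sup.
  - exact: inner_sub.
(* the hulls are Borel, and the inner hulls of A and B combine into C *)
have [-> _] := hull A sA A0 mA; have [-> _] := hull B sB B0 mB.
have [_ ->] := hull C sC C0 mC.
apply: brunn_minkowski_solid => //; do ?exact: measurable_inner;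
  do ?exact: measurable_outer; do ?exact: solid_inner; do ?exact: inner_nonempty.
move=> x [a' /(inner_sub sA) Aa' [b' /(inner_sub sB) Bb' <-]].
by apply: outer_sup => //; exists a' => //; exists b'.
Qed.
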